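(* Let $I$ be an interval and $(X,d)$ a length space. Suppose that $f_n:I\to(0,\infty)$, $n\in\mathbb N$, is a sequence of continuous functions with a positive uniform lower bound (there is $c>0$ with $f_n(t)\ge c$ for all $n$ and all $t\in I$) that converges uniformly on $I$ to $f:I\to(0,\infty)$. (i) Let $X$ be proper and fix $p_0=(t_0,x_0)\in I\times X$. Then $(I\times_{f_n}X,\hat d_{f_n},p_0)\to(I\times_f X,\hat d_f,p_0)$ in the pointed Gromov-Hausdorff sense. (ii) If both $I$ and $X$ are compact, then $(I\times_{f_n}X,\hat d_{f_n})\to(I\times_f X,\hat d_f)$ in the Gromov-Hausdorff sense.
   Context: Length space: a metric space $(X,d)$ in which $d(x,y)$ is the infimum of the $d$-lengths of curves joining $x$ and $y$; it is assumed throughout that any two points can be joined by a curve of finite length. Proper: closed bounded sets are compact. Generalized cone: let $I\subseteq\mathbb R$ be a nondegenerate interval (open, closed or half-open, bounded or not) and $f:I\to(0,\infty)$ continuous. The generalized cone $Y=I\times_f X$ is the set $I\times X$ with the product metric $D((t,x),(t',x'))=|t-t'|+d(x,x')$ and the following causal structure. A curve $\gamma=(\alpha,\beta):J\to Y$ on an interval $J$, with $\alpha:J\to I$ and $\beta:J\to X$ absolutely continuous and $\alpha$ strictly monotone, is causal (timelike) if $-\dot\alpha^2+(f\circ\alpha)^2v_\beta^2\le 0$ ($<0$) almost everywhere, where $v_\beta$ is the metric derivative of $\beta$; it is future (past) directed causal if moreover $\dot\alpha>0$ ($\dot\alpha<0$) a.e. Write $p\le q$ if $p=q$ or there is a future directed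 causal curve from $p$ to $q$. Null distance: a curve $\beta:[a,b]\to Y$ is piecewise causal if there is a partition $a=s_0<\dots<s_k=b$ such that each $\beta|_{[s_{i-1},s_i]}$ is constant, future directed causal or past directed causal. With the time function $t:Y\to\mathbb R$, $t(s,x)=s$, its null length is $\hat L_t(\beta)=\sum_{i=1}^k|t(\beta(s_i))-t(\beta(s_{i-1}))|$, and $\hat d_f(p,q)$ is the infimum of $\hat L_t(\beta)$ over all piecewise causal curves $\beta$ from $p$ to $q$. Pointed Gromov-Hausdorff convergence $(Z_n,z_n)\to(Z,z)$: for every $r>0$ the pointed Gromov-Hausdorff distance between the closed $r$-balls around $z_n$ in $Z_n$ and around $z$ in $Z$ (pointed at their centers) tends to $0$. *)

(* Defs.v *)
From HB Require Import structures.
From mathcomp Require Import all_boot all_order all_algebra.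
From mathcomp Require Import all_classical all_reals all_analysis.

Set Implicit Arguments.
Unset Strict Implicit.
Unset Printing Implicit Defensive.

Import Order.TTheory GRing.Theory Num.Theory.
Import numFieldTopology.Exports numFieldNormedType.Exports.

Local Open Scope classical_set_scope.
Local Open Scope ring_scope.

(* A curve defined on `[a, b] is represented by a total function on R of which
   only the values on `[a, b] matter. *)

Section metric_spaces.
Context {R : realType}.

Section curves.
Context {X : metricType R}.

Definition curve_length (a b : R) (g : R -> X) : \bar R :=
  ereal_sup [set (\sum_(0 <= i < size s)
      mdist (g (nth b (a :: s) i)) (g (nth b (a :: s) i.+1)))%:E
    | s in itv_partition a b].

Definition abs_cont (a b : R) (g : R -> X) :=
  forall e : R, 0 < e -> exists2 r : R, 0 < r &
    forall (n : nat) (u v : 'I_n -> R),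
      (forall i, a <= u i /\ u i <= v i /\ v i <= b) ->
      trivIset [set: 'I_n] (fun i => `]u i, v i[%classic) ->
      \sum_i (v i - u i) < r -> \sum_i mdist (g (u i)) (g (v i)) < e.

Definition has_metric_derivative (g : R -> X) (s v : R) :=
  mdist (g s) (g (s + h)) / `|h| @[h --> 0^'] --> v.

End curves.

(* The left-hand side is finite, so any two points are joined by a curve of
   finite length. *)
Definition length_space (X : metricType R) := forall x y : X,
  (mdist x y)%:E = ereal_inf [set L | exists (a b : R) (g : R -> X),
    [/\ a <= b, {within `[a, b], continuous g}, g a = x, g b = y &
        L = curve_length a b g]].

Definition proper_space (X : metricType R) := forall A : set X,
  closed A -> (exists x r, A `<=` [set y | mdist x y <= r]) -> compact A.

End metric_spaces.

Definition cone {R : realType} (X : metricType R) (I : set R) : set (R * X) :=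
  [set p | I p.1].
Arguments cone {R} X I _.

Section generalized_cone.
Context {R : realType} {X : metricType R}.
Implicit Types (I : set R) (f : R -> R) (g : R -> R * X) (p q : R * X).

Definition strictly_monotone (a b : R) (h : R -> R) :=
  {in `[a, b] &, forall s t, s < t -> h s < h t} \/
  {in `[a, b] &, forall s t, s < t -> h t < h s}.

(* Absolutely continuous curves are differentiable, resp. have a metric
   derivative, almost everywhere; the existence of these derivatives is part of
   the almost everywhere condition, so that no default value is involved. *)
Definition causal_curve I f (a b : R) g :=
  let alpha := fst \o g in let beta := snd \o g in
  [/\ a < b,
      {in `[a, b], forall s, cone X I (g s)},
      abs_cont a b (alpha : R -> R^o) /\ abs_cont a b beta,
      strictly_monotone a b alpha &
      {ae (@lebesgue_measure R), forall s, s \in `]a, b[ ->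
        derivable alpha s 1 /\
        exists2 v, has_metric_derivative beta s v &
          - (derive1 alpha s) ^+ 2 + (f (alpha s)) ^+ 2 * v ^+ 2 <= 0}].

Definition future_causal I f (a b : R) g := causal_curve I f a b g /\
  {ae (@lebesgue_measure R), forall s, s \in `]a, b[ ->
    0 < derive1 (fst \o g) s}.

Definition past_causal I f (a b : R) g := causal_curve I f a b g /\
  {ae (@lebesgue_measure R), forall s, s \in `]a, b[ ->
    derive1 (fst \o g) s < 0}.

(* s lists s_1 < ... < s_k = b; the partition of `[a, b] is a :: s. *)
Definition piecewise_causal I f (a b : R) (s : seq R) g :=
  [/\ itv_partition a b s,
      {in `[a, b], forall t, cone X I (g t)} &
      forall i, (i < size s)%N ->
        let u := nth b (a :: s) i in let v := nth b (a :: s) i.+1 in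
        [\/ {in `[u, v], forall t, g t = g u},
            future_causal I f u v g | past_causal I f u v g]].

(* variation a b (fst \o g) s is the null length of g for the time function
   (s, x) |-> s. The infimum is taken in \bar R, where inf set0 = +oo. *)
Definition null_dist I f p q : \bar R :=
  ereal_inf [set L | exists (a b : R) (s : seq R) (g : R -> R * X),
    [/\ a <= b, piecewise_causal I f a b s g, g a = p, g b = q &
        L = (variation a b (fst \o g) s)%:E]].

End generalized_cone.

(* A metric space is given here as a subset A of a type T together with an
   \bar R-valued distance function on T, of which only the values on A matter. *)
Section Gromov_Hausdorff.
Context {R : realType}.

Definition hausdorff_dist (Z : metricType R) (A B : set Z) : \bar R :=
  ereal_inf [set r%:E | r in [set r : R | [/\ 0 < r,
    (forall x, A x -> exists2 y, B y & mdist x y < r) &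
    (forall y, B y -> exists2 x, A x & mdist x y < r)]]].

Definition isometric_emb (T : Type) (A : set T) (d : T -> T -> \bar R)
    (Z : metricType R) (phi : T -> Z) :=
  forall p q, A p -> A q -> (mdist (phi p) (phi q))%:E = d p q.

Definition gh_dist (T S : Type) (A : set T) (dA : T -> T -> \bar R)
    (B : set S) (dB : S -> S -> \bar R) : \bar R :=
  ereal_inf [set h | exists (Z : metricType R) (phi : T -> Z) (psi : S -> Z),
    [/\ isometric_emb A dA phi, isometric_emb B dB psi &
        h = hausdorff_dist (phi @` A) (psi @` B)]].

Definition pointed_gh_dist (T S : Type)
    (A : set T) (dA : T -> T -> \bar R) (a : T)
    (B : set S) (dB : S -> S -> \bar R) (b : S) : \bar R :=
  ereal_inf [set h | exists (Z : metricType R) (phi : T -> Z) (psi : S -> Z),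
    [/\ isometric_emb A dA phi, isometric_emb B dB psi &
        h = (hausdorff_dist (phi @` A) (psi @` B)
             + (mdist (phi a) (psi b))%:E)%E]].

Definition cball (T : Type) (A : set T) (d : T -> T -> \bar R) (a : T) (r : R) :
  set T := [set x | A x /\ (d a x <= r%:E)%E].

Definition gh_cvg (T S : Type) (A : nat -> set T) (d : nat -> T -> T -> \bar R)
    (B : set S) (dB : S -> S -> \bar R) :=
  gh_dist (A n) (d n) B dB @[n --> \oo] --> 0%E.

Definition pointed_gh_cvg (T S : Type)
    (A : nat -> set T) (d : nat -> T -> T -> \bar R) (a : nat -> T)
    (B : set S) (dB : S -> S -> \bar R) (b : S) :=
  forall r : R, 0 < r ->
    pointed_gh_dist (cball (A n) (d n) (a n) r) (d n) (a n)
                    (cball B dB b r) dB b @[n --> \oo] --> 0%E.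

End Gromov_Hausdorff.

(* Main.v *)
Require Import Defs.
From HB Require Import structures.
From mathcomp Require Import all_boot all_order all_algebra.
From mathcomp Require Import all_classical all_reals all_analysis.
From mathcomp Require Import ring lra.

Set Implicit Arguments.
Unset Strict Implicit.
Unset Printing Implicit Defensive.

Import Order.TTheory GRing.Theory Num.Theory.
Import numFieldTopology.Exports numFieldNormedType.Exports.

Local Open Scope classical_set_scope.
Local Open Scope ring_scope.

(** Why the theorem is true.  The null distance of a generalized cone depends on
the causal curves only through very simple ones.  Call a pair p, q a causal step
if f(u) d(x, y) <= |s - t| for every time u between the times s <> t of p and q,
x and y being their spatial parts; running linearly in time along a geodesic
from x to y is then a causal curve of null length |s - t|.  Let zigzag_dist be
the infimum of the sums of |s - t| over chains of causal steps.

In a proper length space geodesics exist (proper_length_space_geodesic), so that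
chains of steps can be realized by piecewise causal curves (zigzag_curve).
Conversely the endpoints of a causal curve g on [a, b] are at zigzag distance at
most |t(g b) - t(g a)| (zigzag_dist_causal_le): at almost every parameter a short
piece of g is a causal step up to a relative error as small as one wishes, and
absolute continuity makes the remaining parameters negligible; these two facts
are put together by the continuity induction of ae_local_control.  Hence the
null distance is the zigzag distance (null_distE).

For the zigzag distance the comparison of two warping functions is elementary.
Oscillating in time in a region where f <= M, one covers a spatial distance d at
cost M d (reach_same_time), hence a pair of points at time distance h > 0 has
zigzag distance at most max(h, M d) (reach_max).  If g <= lam f with lam >= 1,
a causal step for f of time length h has M d <= lam h for g, whence
zigzag_dist g <= lam * zigzag_dist f (zigzag_dist_scale).  Uniform convergence
together with the lower bound c gives f_ n <= lam f and f <= lam f_ n for all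
large n, for any given lam > 1, so the distances converge uniformly on bounded
sets.

It remains to pass from uniformly close distances to Gromov-Hausdorff
convergence.  Two pseudometrics on the same bounded set A embed in the functions
on A with the sup distance by p |-> d(p, .), and the two images of p are as
close as the pseudometrics are (kuratowski_pair).  For pointed convergence a point
of the closed r-ball of one distance must be moved slightly to reach the closed
r-ball of the other one; this is possible because the zigzag distance has
almost intermediate points (zigzag_dist_intermediate). *)

(** * Gromov-Hausdorff estimates for close pseudometrics *)

(** All functions T -> R with the sup distance truncated at C. Truncation spares
the restriction to bounded functions and is invisible at distances at most C;
C is an argument of the alias so that it determines the metric structure. *)
Definition trunc_fun (R : realType) (T : Type) (C : {posnum R}) : Type := T -> R.

Section truncated_sup.
Context {R : realType} (T : Type) (C : {posnum R}).
Local Notation trunc_fun := (trunc_fun T C).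

HB.instance Definition _ := gen_eqMixin trunc_fun.
HB.instance Definition _ := gen_choiceMixin trunc_fun.

Definition trunc_dist (u v : trunc_fun) : R :=
  sup (range (fun z => Num.min C%:num `|u z - v z|)).

Lemma trunc_dist_ub u v z : Num.min C%:num `|u z - v z| <= trunc_dist u v.
Proof.
apply: ub_le_sup; last by exists z.
by exists C%:num => _ [w _ <-]; rewrite ge_min lexx.
Qed.

Lemma trunc_dist_le u v (M : R) : 0 <= M ->
  (forall z, Num.min C%:num `|u z - v z| <= M) -> trunc_dist u v <= M.
Proof.
move=> M0 uvM; rewrite /trunc_dist.
have [->|/set0P ne] := eqVneq (range (fun z => Num.min C%:num `|u z - v z|)) set0.
  by rewrite sup0.
by apply: ge_sup => // _ [z _ <-].
Qed.

Let trunc_dist_ge0 u v : 0 <= trunc_dist u v.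
Proof.
rewrite /trunc_dist.
have [->|/set0P[_ [z _ _]]] := eqVneq (range (fun z => Num.min C%:num `|u z - v z|)) set0.
  by rewrite sup0.
by apply: (le_trans _ (trunc_dist_ub u v z)); rewrite le_min normr_ge0 andbT.
Qed.

Let trunc_distxx u : trunc_dist u u = 0.
Proof.
apply/eqP; rewrite eq_le trunc_dist_ge0 andbT.
by apply: trunc_dist_le => // z; rewrite subrr normr0 ge_min lexx orbT.
Qed.

Let trunc_dist_eq0 u v : trunc_dist u v = 0 -> u = v.
Proof.
move=> uv0; apply/funext => z; have := trunc_dist_ub u v z.
rewrite uv0 ge_min leNgt gt0 /= normr_le0 subr_eq0.
by move/eqP.
Qed.

Let trunc_dist_sym u v : trunc_dist u v = trunc_dist v u.
Proof.
by congr (sup (image _ _)); apply/funext => z; rewrite distrC.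
Qed.

Let trunc_dist_triangle v u w :
  trunc_dist u w <= trunc_dist u v + trunc_dist v w.
Proof.
apply: trunc_dist_le => [|z]; first by rewrite addr_ge0.
apply: (le_trans _ (lerD (trunc_dist_ub u v z) (trunc_dist_ub v w z))).
have := ler_distD (v z) (u z) (w z).
have := [gt0 of C%:num]; move: (C%:num) => c.
have := normr_ge0 (u z - v z); have := normr_ge0 (v z - w z).
move: (`|_|) (`|_|) (`|_|) => x y t x0 y0 c0 ht.
by rewrite !minEle; do !case: ifP; lra.
Qed.

HB.instance Definition _ := isMetric.Build R trunc_fun
  trunc_distxx trunc_dist_eq0 trunc_dist_sym trunc_dist_triangle.

Lemma trunc_mdistE (u v : trunc_fun) : mdist u v = trunc_dist u v.
Proof. by []. Qed.

End truncated_sup.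

Section abstract_GH.
Context {R : realType} {T : Type}.
Implicit Types (A : set T) (d : T -> T -> R).

Definition pseudometric_on A d :=
  [/\ forall x, A x -> d x x = 0,
      forall x y, A x -> A y -> d x y = d y x &
      forall x y z, A x -> A y -> A z -> d x z <= d x y + d y z].

(** A weak form of being a length metric: a point that splits d x y in any
prescribed proportion, up to an arbitrarily small loss. *)
Definition has_intermediate_points A d :=
  forall x y (L r : R), A x -> A y -> d x y < L -> 0 <= r <= L ->
    exists z, [/\ A z, d x z <= r & d z y <= L - r].

Lemma pseudometric_on_ge0 A d x y :
  pseudometric_on A d -> A x -> A y -> 0 <= d x y.
Proof.
move=> [d0 ds dt] Ax Ay; have := dt _ _ _ Ax Ay Ax.
by rewrite d0// (ds y x)//; lra.
Qed.

Lemma pseudometric_onS A B d :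
  B `<=` A -> pseudometric_on A d -> pseudometric_on B d.
Proof.
move=> BA [d0 ds dt]; split => *; [apply: d0|apply: ds|apply: dt]; exact: BA.
Qed.

(** Two pseudometrics that are uniformly eta-close on A are realized in one metric
space with eta-close images, by the Kuratowski embedding x |-> d x into
functions on A; the same target serves both of them since both are indexed by
the same set A. *)
Lemma kuratowski_pair A d1 d2 (C eta : R) : 0 < C -> 0 <= eta ->
  pseudometric_on A d1 -> pseudometric_on A d2 ->
  (forall x y, A x -> A y -> d1 x y <= C) ->
  (forall x y, A x -> A y -> d2 x y <= C) ->
  (forall x y, A x -> A y -> `|d1 x y - d2 x y| <= eta) ->
  exists (Z : metricType R) (phi psi : T -> Z),
    [/\ forall x y, A x -> A y -> mdist (phi x) (phi y) = d1 x y,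
        forall x y, A x -> A y -> mdist (psi x) (psi y) = d2 x y &
        forall x, A x -> mdist (phi x) (psi x) <= eta].
Proof.
move=> C0 eta0 pm1 pm2 d1C d2C d12.
pose Z : metricType R := @trunc_fun R T (PosNum C0).
pose kur d : T -> Z := fun x z => if `[< A z >] then d x z else 0.
have kurE d x y : pseudometric_on A d -> (forall x y, A x -> A y -> d x y <= C) ->
    A x -> A y -> mdist (kur d x) (kur d y) = d x y.
  move=> pm dC Ax Ay; have [d0 ds dt] := pm.
  rewrite trunc_mdistE; apply/eqP; rewrite eq_le; apply/andP; split.
    apply: trunc_dist_le => [|z]; first exact: pseudometric_on_ge0 pm _ _.
    rewrite ge_min /kur; case: asboolP => Az; last first.
      by rewrite subrr normr0 (pseudometric_on_ge0 pm)// orbT.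
    apply/orP; right; rewrite ler_norml.
    have := dt _ _ _ Ax Ay Az; have := dt _ _ _ Ay Ax Az.
    by rewrite (ds y x)//; lra.
  apply: (le_trans _ (trunc_dist_ub _ _ _ y)); rewrite /kur asboolT//.
  by rewrite d0// subr0 le_min dC//= ler_norm.
exists Z, (kur d1), (kur d2); split => [x y|x y|x Ax]; try exact: kurE.
rewrite trunc_mdistE; apply: trunc_dist_le => // z; rewrite ge_min /kur.
case: asboolP => Az; last by rewrite subrr normr0 eta0 orbT.
by rewrite d12// orbT.
Qed.

Lemma hausdorff_dist_le (Z : metricType R) (A B : set Z) (r : R) : 0 < r ->
  (forall x, A x -> exists2 y, B y & mdist x y < r) ->
  (forall y, B y -> exists2 x, A x & mdist x y < r) ->
  (hausdorff_dist A B <= r%:E)%E.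
Proof. by move=> r0 AB BA; apply: ereal_inf_lbound; exists r. Qed.

Lemma hausdorff_dist_ge0 (Z : metricType R) (A B : set Z) :
  (0 <= hausdorff_dist A B)%E.
Proof. by apply: le_ereal_inf_tmp => _ [r [r0 _ _] <-]; rewrite lee_fin ltW. Qed.


Lemma gh_dist_ge0 (A B : set T) (dA dB : T -> T -> \bar R) :
  (0 <= gh_dist A dA B dB)%E.
Proof.
apply: le_ereal_inf_tmp => _ [Z [phi [psi [_ _ ->]]]].
exact: hausdorff_dist_ge0.
Qed.

Lemma pointed_gh_dist_ge0 (A B : set T) (dA dB : T -> T -> \bar R) a b :
  (0 <= pointed_gh_dist A dA a B dB b)%E.
Proof.
apply: le_ereal_inf_tmp => _ [Z [phi [psi [_ _ ->]]]].
by rewrite adde_ge0 ?hausdorff_dist_ge0// lee_fin mdist_ge0.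
Qed.

(** A multiplicative comparison of distances bounded by C is an additive one with
error of order (lam - 1) C, which bounds the distance of the two
Kuratowski images. *)
Lemma gh_dist_le A d1 d2 (e1 e2 : T -> T -> \bar R) (C lam : R) :
  pseudometric_on A d1 -> pseudometric_on A d2 ->
  (forall x y, A x -> A y -> e1 x y = (d1 x y)%:E) ->
  (forall x y, A x -> A y -> e2 x y = (d2 x y)%:E) ->
  0 < C -> (forall x y, A x -> A y -> d2 x y <= C) ->
  1 < lam -> lam <= 2 ->
  (forall x y, A x -> A y -> d1 x y <= lam * d2 x y) ->
  (forall x y, A x -> A y -> d2 x y <= lam * d1 x y) ->
  (gh_dist A e1 A e2 <= ((lam - 1) * (4 * C))%:E)%E.
Proof.
move=> pm1 pm2 e1E e2E C0 d2C lam1 lam2 d12 d21.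
have lC : 0 < (lam - 1) * C by rewrite mulr_gt0 ?subr_gt0.
have d1C x y : A x -> A y -> d1 x y <= C * 2.
  move=> Ax Ay; apply: le_trans (d12 _ _ Ax Ay) _; rewrite mulrC.
  by apply: ler_pM => //; [exact: pseudometric_on_ge0 pm2 _ _|lra|exact: d2C].
have dist12 x y : A x -> A y -> `|d1 x y - d2 x y| <= (lam - 1) * (C * 2).
  move=> Ax Ay; have := d12 _ _ Ax Ay; have := d21 _ _ Ax Ay.
  have := d1C _ _ Ax Ay; have := d2C _ _ Ax Ay.
  move: (pseudometric_on_ge0 pm1 Ax Ay) (pseudometric_on_ge0 pm2 Ax Ay).
  move: (d1 x y) (d2 x y) => u v u0 v0 vC uC vu uv; rewrite ler_norml.
  have := ler_wpM2l (ltW (_ : 0 < lam - 1)) vC; rewrite subr_gt0 => /(_ lam1).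
  have := ler_wpM2l (ltW (_ : 0 < lam - 1)) uC; rewrite subr_gt0 => /(_ lam1).
  by nra.
have [||||Z [phi [psi [phiE psiE phipsi]]]] :=
  @kuratowski_pair A d1 d2 (C * 2) ((lam - 1) * (C * 2)) _ _ pm1 pm2 _ _ dist12.
- lra.
- lra.
- exact: d1C.
- by move=> x y Ax Ay; apply: le_trans (d2C _ _ Ax Ay) _; lra.
apply: (@le_trans _ _ (hausdorff_dist (phi @` A) (psi @` A))).
  apply: ereal_inf_lbound; exists Z, phi, psi; split => // x y Ax Ay.
    by rewrite phiE// e1E.
  by rewrite psiE// e2E.
apply: hausdorff_dist_le; first lra.
- move=> _ [x Ax <-]; exists (psi x); first by exists x.
  by apply: le_lt_trans (phipsi _ Ax) _; lra.
- move=> _ [x Ax <-]; exists (phi x); first by exists x.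
  by apply: le_lt_trans (phipsi _ Ax) _; lra.
Qed.

(** The two closed balls differ as sets, but both lie in the ball of radius 2 r for
d1, on which the distances are (lam - 1) * 8 r close. A point x with d1 p x <= r
satisfies d2 p x <= lam r, and an almost intermediate point z at d2-distance at
most r from p is then a point of the other ball close to x. *)
Lemma pointed_gh_dist_le A d1 d2 (e1 e2 : T -> T -> \bar R) p (r lam : R) :
  pseudometric_on A d1 -> pseudometric_on A d2 ->
  has_intermediate_points A d1 -> has_intermediate_points A d2 ->
  (forall x y, A x -> A y -> e1 x y = (d1 x y)%:E) ->
  (forall x y, A x -> A y -> e2 x y = (d2 x y)%:E) ->
  A p -> 0 < r -> 1 < lam -> lam <= 2 ->
  (forall x y, A x -> A y -> d1 x y <= lam * d2 x y) ->
  (forall x y, A x -> A y -> d2 x y <= lam * d1 x y) ->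
  (pointed_gh_dist (cball A e1 p r) e1 p (cball A e2 p r) e2 p
     <= ((lam - 1) * (20 * r))%:E)%E.
Proof.
move=> pm1 pm2 mid1 mid2 e1E e2E Ap r0 lam1 lam2 d12 d21.
pose A' := [set x | A x /\ d1 p x <= 2 * r].
have A'A : A' `<=` A by move=> x [].
have lr : 0 < (lam - 1) * r by rewrite mulr_gt0 ?subr_gt0.
have ball1 x : cball A e1 p r x -> A x /\ d1 p x <= r.
  by move=> [Ax]; rewrite e1E// lee_fin.
have ball2 x : cball A e2 p r x -> A x /\ d2 p x <= r.
  by move=> [Ax]; rewrite e2E// lee_fin.
have sub1 : cball A e1 p r `<=` A'.
  by move=> x /ball1[Ax pxr]; split => //; lra.
have sub2 : cball A e2 p r `<=` A'.
  move=> x /ball2[Ax pxr]; split => //; apply: le_trans (d12 _ _ Ap Ax) _.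
  have := pseudometric_on_ge0 pm2 Ap Ax; nra.
have A'p : A' p by split => //; rewrite (let: And3 d0 _ _ := pm1 in d0 _ Ap); lra.
have d1C x y : A' x -> A' y -> d1 x y <= 8 * r.
  move=> [Ax px] [Ay py]; have [_ ds dt] := pm1.
  by have := dt _ _ _ Ax Ap Ay; rewrite (ds x p)//; lra.
have d2C x y : A' x -> A' y -> d2 x y <= 8 * r.
  move=> [Ax px] [Ay py]; have [_ ds dt] := pm1.
  have := dt _ _ _ Ax Ap Ay; rewrite (ds x p)// => h.
  have := d21 _ _ Ax Ay; have := pseudometric_on_ge0 pm1 Ax Ay; nra.
have dist12 x y : A' x -> A' y -> `|d1 x y - d2 x y| <= (lam - 1) * (8 * r).
  move=> A'x A'y; have Ax := A'A _ A'x; have Ay := A'A _ A'y.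
  have := d12 _ _ Ax Ay; have := d21 _ _ Ax Ay.
  have := d1C _ _ A'x A'y; have := d2C _ _ A'x A'y.
  move: (pseudometric_on_ge0 pm1 Ax Ay) (pseudometric_on_ge0 pm2 Ax Ay).
  move: (d1 x y) (d2 x y) => u v u0 v0 vC uC vu uv; rewrite ler_norml.
  have := ler_wpM2l (ltW (_ : 0 < lam - 1)) vC; rewrite subr_gt0 => /(_ lam1).
  have := ler_wpM2l (ltW (_ : 0 < lam - 1)) uC; rewrite subr_gt0 => /(_ lam1).
  by nra.
have [||Z [phi [psi [phiE psiE phipsi]]]] := @kuratowski_pair A' d1 d2 (8 * r)
  ((lam - 1) * (8 * r)) _ _ (pseudometric_onS A'A pm1) (pseudometric_onS A'A pm2)
  d1C d2C dist12; [lra|lra|].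
apply: (@le_trans _ _ (hausdorff_dist (phi @` cball A e1 p r) (psi @` cball A e2 p r)
             + (mdist (phi p) (psi p))%:E)%E).
  apply: ereal_inf_lbound; exists Z, phi, psi; split => // x y.
    by move=> /sub1 A'x /sub1 A'y; rewrite phiE// e1E//; exact: A'A.
  by move=> /sub2 A'x /sub2 A'y; rewrite psiE// e2E//; exact: A'A.
have -> : (lam - 1) * (20 * r) = (lam - 1) * (12 * r) + (lam - 1) * (8 * r) by ring.
rewrite EFinD leeD ?lee_fin ?phipsi//.
apply: hausdorff_dist_le; first lra.
- move=> _ [x Bx <-]; have A'x := sub1 _ Bx; have [Ax px] := ball1 _ Bx.
  have h2 : d2 p x < (2 * lam - 1) * r.
    have := d21 _ _ Ap Ax; have := pseudometric_on_ge0 pm1 Ap Ax; nra.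
  have [|z [Az pz zx]] := mid2 p x _ r Ap Ax h2; first by apply/andP; split; nra.
  have Bz : cball A e2 p r z by split => //; rewrite e2E// lee_fin.
  exists (psi z); first by exists z.
  apply: le_lt_trans (metric_triangle _ (psi x) _) _; have := phipsi _ A'x.
  rewrite psiE//; last exact: sub2.
  by rewrite (let: And3 _ ds _ := pm2 in ds x z Ax Az); lra.
- move=> _ [x Bx <-]; have A'x := sub2 _ Bx; have [Ax px] := ball2 _ Bx.
  have h1 : d1 p x < (2 * lam - 1) * r.
    have := d12 _ _ Ap Ax; have := pseudometric_on_ge0 pm2 Ap Ax; nra.
  have [|z [Az pz zx]] := mid1 p x _ r Ap Ax h1; first by apply/andP; split; nra.
  have Bz : cball A e1 p r z by split => //; rewrite e1E// lee_fin.
  exists (phi z); first by exists z.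
  apply: le_lt_trans (metric_triangle _ (phi x) _) _; have := phipsi _ A'x.
  rewrite phiE//; last exact: sub1.
  by lra.
Qed.

End abstract_GH.

Lemma cvge0_eventually_le (R : realType) (u : nat -> \bar R) :
  (forall n, (0 <= u n)%E) ->
  (forall e : R, 0 < e -> \forall n \near \oo, (u n <= e%:E)%E) ->
  u n @[n --> \oo] --> 0%E.
Proof.
move=> u0 ule; apply/fine_cvgP; split.
  have := ule _ ltr01; apply: filterS => n un1.
  by rewrite ge0_fin_numE// (le_lt_trans un1)// ltry.
apply/cvgrPdist_le => e e0; have := ule _ e0; apply: filterS => n une /=.
rewrite sub0r normrN ger0_norm ?fine_ge0//.
by rewrite -lee_fin fineK// ge0_fin_numE// (le_lt_trans une)// ltry.
Qed.

(** * Geodesics in proper length spaces *)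

Section geodesics.
Context {R : realType} {X : metricType R}.
Implicit Types x y : X.

(** The four parameters may coincide, so the partition that witnesses the
inequality is assembled from possibly empty pieces. *)
Lemma curve_length_ge (a b s t : R) (g : R -> X) : a <= s -> s <= t -> t <= b ->
  ((mdist (g a) (g s) + mdist (g s) (g t) + mdist (g t) (g b))%:E
    <= curve_length a b g)%E.
Proof.
move=> as_ st tb.
pose cut u v : seq R := if u < v then [:: v] else [::].
have part u v : u <= v -> itv_partition u v (cut u v).
  rewrite le_eqVlt /cut => /orP[/eqP->|uv]; first by rewrite ltxx; split => /=.
  by rewrite uv; exact: itv_partition1.
have := itv_partition_cat (itv_partition_cat (part _ _ as_) (part _ _ st)) (part _ _ tb).
move=> pab; apply: ereal_sup_ubound; exists (cut a s ++ cut s t ++ cut t b).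
  by rewrite catA.
congr EFin; rewrite /cut.
move: as_ st tb {pab}; rewrite !le_eqVlt.
by do 3 (case: eqVneq => [<- _|_ /= ->]; rewrite ?ltxx ?mdistxx) => /=;
  rewrite ?big_nat_recr//= ?big_geq//= ?add0r ?addr0.
Qed.

Lemma mdist_continuous (a b : R) (g : R -> X) x :
  {within `[a, b], continuous g} ->
  {within `[a, b], continuous (fun s => mdist x (g s))}.
Proof.
move=> /subspace_continuousP gc; apply/subspace_continuousP => s sab.
apply/cvgrPdist_le => e e0.
have /metricType_numDomainType.cvgrPdist_le/(_ _ e0) := gc _ sab.
apply: filterS => t; rewrite /from_subspace /=; apply: le_trans; rewrite ler_norml.
have := metric_triangle x (g t) (g s); have := metric_triangle x (g s) (g t).
by rewrite (metric_sym (g t)); lra.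
Qed.

Lemma closed_mdist_ball x (r : R) : closed [set y | mdist x y <= r].
Proof.
move=> y cly /=; apply/ler_addgt0Pl => e e0.
have [z [/= xz]] := cly _ (nbhsx_ballx y e e0).
rewrite ballEmdist/= => yz; apply: le_trans (metric_triangle x z y) _.
by rewrite (metric_sym z) addrC lerD// ltW.
Qed.

(** An ultrafilter on the indices selects limits for all sequences with values in a
compact set at once. This replaces the extraction of a subsequence when limits
are needed at uncountably many parameters. *)
Lemma ultrafilter_limit (U : set_system nat) (K : set X) (u : nat -> X) :
  UltraFilter U -> compact K -> (forall n, K (u n)) ->
  exists2 p, K p & forall e : R, 0 < e -> \forall n \near U, mdist p (u n) < e.
Proof.
move=> UU Kc Ku; have [|p [Kp clp]] := Kc (u n @[n --> U]) _.
  by apply: (@filterE _ U) => n; exact: Ku.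
exists p => // e e0.
have [//|far] := in_ultra_setVsetC [set n | mdist p (u n) < e] UU.
have [q [/= qfar]] : [set q | ~ mdist p q < e] `&` ball p e !=set0.
  by apply: clp; [exact: far|exact: nbhsx_ballx].
by rewrite ballEmdist.
Qed.

(** On a curve from x to y of length less than d x y + e, let g s be any point at
distance s * d x y from x, given by the intermediate value theorem. In which
order the curve meets these points is irrelevant: the length of the curve
bounds d x (g s) + d (g s) (g t) + d (g t) y or the same sum with s, t exchanged. *)
Lemma approximate_geodesic x y (e : R) : length_space X -> 0 < e ->
  exists g : R -> X, forall s t, 0 <= s <= 1 -> 0 <= t <= 1 ->
    [/\ mdist x (g s) <= s * mdist x y,
        mdist (g s) y <= (1 - s) * mdist x y + e &
        mdist (g s) (g t) <= `|s - t| * mdist x y + e].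
Proof.
move=> lX e0; set D := mdist x y.
have D0 : 0 <= D by exact: mdist_ge0.
have : ((mdist x y)%:E < (D + e)%:E)%E by rewrite lte_fin ltrDl.
rewrite lX.
move=> /ereal_inf_lt[L0 [a [b [g [ab gc ga gb L0E]]]]]; rewrite L0E => Le.
have gE s t : a <= s -> s <= t -> t <= b ->
    mdist x (g s) + mdist (g s) (g t) + mdist (g t) y < D + e.
  move=> as_ st tb; rewrite -lte_fin; apply: le_lt_trans Le.
  by rewrite -{1}ga -gb; exact: curve_length_ge.
have /choice[c cP] : forall s, exists u, 0 <= s <= 1 ->
    u \in `[a, b] /\ mdist x (g u) = s * D.
  move=> s; case: (boolP (0 <= s <= 1)) => [/andP[s0 s1]|_]; last by exists a.
  have [||u uab uE] := @IVT _ (fun u => mdist x (g u)) a b (s * D) ab.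
  - exact: mdist_continuous.
  - rewrite ga gb mdistxx -/D ge_min le_max.
    by rewrite mulr_ge0//= ler_piMl// orbT.
  - by exists u.
exists (g \o c) => s t s01 t01 /=.
have [] := cP _ s01; have [] := cP _ t01.
rewrite !in_itv/=; move: (c s) (c t) => u v /andP[av vb] vE /andP[au ub] uE.
rewrite uE; split=> //.
  by have := gE _ _ au (lexx _) ub; rewrite mdistxx uE; lra.
have tri1 := metric_triangle x (g u) y; have tri2 := metric_triangle x (g v) y.
rewrite -/D in tri1 tri2.
have hst : (s - t) * D <= `|s - t| * D by rewrite ler_wpM2r// ler_norm.
have hts : (t - s) * D <= `|s - t| * D by rewrite ler_wpM2r// distrC ler_norm.
have [uv|/ltW vu] := leP u v.
  by have := gE _ _ au uv vb; lra.
by have := gE _ _ av vu ub; rewrite (metric_sym (g v)); lra.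
Qed.

(** The pointwise limit of approximate geodesics along an ultrafilter. The limit
satisfies only upper bounds a priori, and the triangle inequality between x and
y forces all of them to be equalities. *)
Lemma proper_length_space_geodesic x y : length_space X -> proper_space X ->
  exists g : R -> X, [/\ g 0 = x, g 1 = y &
    forall s t, 0 <= s <= 1 -> 0 <= t <= 1 ->
      mdist (g s) (g t) = `|s - t| * mdist x y].
Proof.
move=> lX pX; set D := mdist x y.
have D0 : 0 <= D by exact: mdist_ge0.
have /choice[a aP] n : exists g : R -> X, forall s t, 0 <= s <= 1 -> 0 <= t <= 1 ->
    [/\ mdist x (g s) <= s * D, mdist (g s) y <= (1 - s) * D + n.+1%:R^-1 &
        mdist (g s) (g t) <= `|s - t| * D + n.+1%:R^-1].
  by apply: approximate_geodesic => //; rewrite invr_gt0.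
have [U [UU Usub]] := @ultraFilterLemma nat \oo _.
have Usmall (e : R) : 0 < e -> \forall n \near U, n.+1%:R^-1 < e.
  move=> e0; apply: Usub; near=> n.
  near: n; exact: near_infty_natSinv_lt (PosNum e0).
have /choice[g gP] s : exists p, 0 <= s <= 1 ->
    forall e : R, 0 < e -> \forall n \near U, mdist p (a n s) < e.
  case: (boolP (0 <= s <= 1)) => [s01|_]; last by exists x.
  have [|n|p _ pP] := @ultrafilter_limit U [set z | mdist x z <= D] (a ^~ s) UU.
  - by apply: pX; [exact: closed_mdist_ball|exists x, D].
  - have [h _ _] := aP n _ _ s01 s01; apply: le_trans h _.
    by move/andP: s01 => [_ s1]; rewrite ler_piMl.
  - by exists p => _.
have gleft s : 0 <= s <= 1 -> mdist x (g s) <= s * D.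
  move=> s01; apply/ler_addgt0Pr => e e0.
  have [n /= nP] := filter_ex (gP _ s01 _ e0); have [h _ _] := aP n _ _ s01 s01.
  by have := metric_triangle x (a n s) (g s); rewrite (metric_sym (a n s)); lra.
have gright s : 0 <= s <= 1 -> mdist (g s) y <= (1 - s) * D.
  move=> s01; apply/ler_addgt0Pr => e e0.
  have e2 : 0 < e / 2 by lra.
  have [n /= [nP nS]] := filter_ex (filterI (gP _ s01 _ e2) (Usmall _ e2)).
  have [_ h _] := aP n _ _ s01 s01.
  move: (n.+1%:R^-1) nS h => i nS h.
  by have := metric_triangle (g s) (a n s) y; lra.
have gmid s t : 0 <= s <= 1 -> 0 <= t <= 1 -> mdist (g s) (g t) <= `|s - t| * D.
  move=> s01 t01; apply/ler_addgt0Pr => e e0.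
  have e3 : 0 < e / 3 by lra.
  have [n /= [[sP tP] nS]] :=
    filter_ex (filterI (filterI (gP _ s01 _ e3) (gP _ t01 _ e3)) (Usmall _ e3)).
  have [_ _ h] := aP n _ _ s01 t01; move: (n.+1%:R^-1) nS h => i nS h.
  have := metric_triangle (g s) (a n s) (g t).
  have := metric_triangle (a n s) (a n t) (g t).
  by rewrite (metric_sym (a n t) (g t)); lra.
have I0 : 0 <= (0 : R) <= 1 by apply/andP; split; lra.
have I1 : 0 <= (1 : R) <= 1 by apply/andP; split; lra.
have gE s t : 0 <= s -> s <= t -> t <= 1 -> mdist (g s) (g t) = `|s - t| * D.
  move=> s0 st t1.
  have s01 : 0 <= s <= 1 by rewrite s0 (le_trans st).
  have t01 : 0 <= t <= 1 by rewrite t1 (le_trans s0).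
  apply/eqP; rewrite eq_le gmid//= distrC ger0_norm ?subr_ge0//.
  have := gleft _ s01; have := gright _ t01.
  have := metric_triangle x (g s) y; have := metric_triangle (g s) (g t) y.
  by rewrite -/D; lra.
exists g; split.
- apply/esym/mdist_positivity/eqP; rewrite eq_le mdist_ge0 andbT.
  by have := gleft _ I0; rewrite mul0r.
- apply/mdist_positivity/eqP; rewrite eq_le mdist_ge0 andbT.
  by have := gright _ I1; rewrite subrr mul0r.
- move=> s t /andP[s0 s1] /andP[t0 t1]; have [st|/ltW ts] := leP s t; first exact: gE.
  by rewrite metric_sym distrC; exact: gE.
Unshelve. all: by end_near. Qed.

End geodesics.

(** * The zigzag distance *)

Lemma compact_real_bounded (R : realType) (A : set R) : compact A ->
  exists M, forall x, A x -> `|x| <= M.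
Proof.
move=> /compact_bounded[M [_ MP]]; exists (M + 1); apply: MP.
by rewrite ltrDl.
Qed.

Definition between {R : realType} (s t u : R) := s <= u <= t \/ t <= u <= s.

Section zigzag.
Context {R : realType} {X : metricType R}.
Implicit Types (I : set R) (f : R -> R) (p q z : R * X).

(** The steps p -> q that a curve linear in time and geodesic in space performs
causally, towards the future or the past. *)
Definition causal_step I f p q := [/\ I p.1, I q.1, p.1 != q.1 &
  forall u, between p.1 q.1 u -> f u * mdist p.2 q.2 <= `|p.1 - q.1|].

Inductive zigzag I f p : R * X -> R -> Prop :=
| zigzag_nil : I p.1 -> zigzag I f p p 0
| zigzag_rcons z q L : zigzag I f p z L -> causal_step I f z q ->
    zigzag I f p q (L + `|z.1 - q.1|).

Definition zigzag_dist I f p q : R := inf [set L | zigzag I f p q L].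

(** An upper bound for zigzag_dist which also says that zigzags exist; estimates
are proved in this form because the infimum of the empty set is 0 in R. *)
Definition reach I f p q (L : R) := exists2 L', zigzag I f p q L' & L' <= L.

Lemma betweenC (s t u : R) : between s t u -> between t s u.
Proof. by case; [right|left]. Qed.

Lemma causal_step_sym I f p q : causal_step I f p q -> causal_step I f q p.
Proof.
move=> [Ip Iq pq fpq]; split; rewrite 1?eq_sym// => u /betweenC/fpq.
by rewrite metric_sym distrC.
Qed.

Lemma zigzag_ge I f p q L : zigzag I f p q L -> `|p.1 - q.1| <= L.
Proof.
elim=> [|z {}q {}L _ IH _]; first by rewrite subrr normr0.
by apply: le_trans (ler_distD z.1 _ _) _; rewrite lerD2r.
Qed.

Lemma zigzag_ge0 I f p q L : zigzag I f p q L -> 0 <= L.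
Proof. by move/zigzag_ge; apply: le_trans. Qed.

Lemma zigzag_trans I f p q z L M :
  zigzag I f p q L -> zigzag I f q z M -> zigzag I f p z (L + M).
Proof.
move=> pq; elim=> [|w {}z {}M _ IH wz]; first by rewrite addr0.
by rewrite addrA; apply: zigzag_rcons wz.
Qed.

Lemma zigzag_sym I f p q L : zigzag I f p q L -> zigzag I f q p L.
Proof.
elim=> [|z {}q {}L _ IH /causal_step_sym qz]; first exact: zigzag_nil.
have [Iq _ _ _] := qz; rewrite addrC distrC -[`|_|]add0r.
by apply: zigzag_trans IH; apply: zigzag_rcons qz; exact: zigzag_nil.
Qed.

Lemma reach_refl I f p : I p.1 -> reach I f p p 0.
Proof. by move=> Ip; exists 0 => //; exact: zigzag_nil. Qed.

Lemma reach_step I f p q : causal_step I f p q -> reach I f p q `|p.1 - q.1|.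
Proof.
move=> pq; exists (0 + `|p.1 - q.1|); last by rewrite add0r.
by apply: zigzag_rcons (pq); apply: zigzag_nil; case: pq.
Qed.

Lemma reach_le I f p q L M : reach I f p q L -> L <= M -> reach I f p q M.
Proof. by move=> [L' pq L'L LM]; exists L' => //; exact: le_trans LM. Qed.

Lemma reach_trans I f p q z L M :
  reach I f p q L -> reach I f q z M -> reach I f p z (L + M).
Proof.
move=> [L' pq LL'] [M' qz MM']; exists (L' + M'); last exact: lerD.
exact: zigzag_trans qz.
Qed.

Lemma reach_sym I f p q L : reach I f p q L -> reach I f q p L.
Proof. by move=> [L' pq LL']; exists L' => //; exact: zigzag_sym. Qed.

Lemma zigzag_dist_le I f p q L : reach I f p q L -> zigzag_dist I f p q <= L.
Proof.
move=> [L' pq]; apply: le_trans; apply: ge_inf => //.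
by exists 0 => M; exact: zigzag_ge0.
Qed.

Lemma zigzag_dist_ge0 I f p q : 0 <= zigzag_dist I f p q.
Proof.
rewrite /zigzag_dist.
have [->|/set0P ne] := eqVneq [set L | zigzag I f p q L] set0; first by rewrite inf0.
by apply: lb_le_inf => // L; exact: zigzag_ge0.
Qed.

End zigzag.

Definition geodesic_space {R : realType} (X : metricType R) := forall x y : X,
  exists g : R -> X, [/\ g 0 = x, g 1 = y &
    forall s t, 0 <= s <= 1 -> 0 <= t <= 1 ->
      mdist (g s) (g t) = `|s - t| * mdist x y].

Section zigzag_estimates.
Context {R : realType} {X : metricType R} (geoX : geodesic_space X).
Context (I : set R) (I_itv : is_interval I).
Implicit Types (f : R -> R) (p q z : R * X).

Lemma between_interval (s t u : R) : I s -> I t -> between s t u -> I u.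
Proof.
move=> Is It [] ; first exact: I_itv.
exact: I_itv.
Qed.

Lemma geodesic_point (x y : X) (th : R) : 0 <= th <= 1 ->
  exists2 m, mdist x m = th * mdist x y & mdist m y = (1 - th) * mdist x y.
Proof.
move=> th01; have [g [g0 g1 gE]] := geoX x y; have /andP[th0 th1] := th01.
exists (g th).
  by rewrite -{1}g0 gE ?lexx ?ler01// sub0r normrN ger0_norm.
by rewrite -{1}g1 gE ?lexx ?ler01// distrC ger0_norm// subr_ge0.
Qed.

Lemma causal_step_partial f p q (th : R) (m : X) : causal_step I f p q ->
  0 < th <= 1 -> mdist p.2 m = th * mdist p.2 q.2 ->
  causal_step I f p (p.1 + th * (q.1 - p.1), m).
Proof.
move=> [Ip Iq pq fpq] /andP[th0 th1] pm.
have btw u : between p.1 (p.1 + th * (q.1 - p.1)) u -> between p.1 q.1 u.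
  move: (p.1) (q.1) => a b; case=> /andP[h1 h2]; [left|right]; apply/andP; split=> //.
    have h : 0 <= th * (b - a) by rewrite -(lerD2l a) addr0; exact: le_trans h2.
    by rewrite pmulr_rge0// in h; nra.
  have h : th * (b - a) <= 0 by rewrite -(lerD2l a) addr0; exact: le_trans h2.
  by rewrite pmulr_rle0// in h; nra.
split => //=.
- apply: between_interval Ip Iq _; apply: btw.
  have [h|/ltW h] := leP p.1 (p.1 + th * (q.1 - p.1)); [left|right].
    by rewrite h lexx.
  by rewrite h lexx.
- rewrite -subr_eq0 opprD addNKr oppr_eq0 mulf_eq0 subr_eq0 (eq_sym q.1).
  by rewrite (negbTE pq) orbF gt_eqF.
- move=> u /btw/fpq h; rewrite opprD addNKr normrN normrM gtr0_norm// pm.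
  by rewrite mulrCA ler_pM2l// distrC.
Qed.

(** If M d <= |s - t|, go half of the geodesic towards the time s and come back.
Otherwise cut the geodesic in two and proceed by induction on the number of
halvings. *)
Lemma reach_same_time f (s t M : R) (x y : X) : I s -> I t -> s != t -> 0 < M ->
  (forall u, between s t u -> f u <= M) ->
  reach I f (t, x) (t, y) (M * mdist x y).
Proof.
move=> Is It st M0 fM.
have st0 : 0 < `|s - t| by rewrite normr_gt0 subr_eq0.
have base (a b : X) : M * mdist a b <= `|s - t| -> reach I f (t, a) (t, b) (M * mdist a b).
  move=> Mab; have [->|ab] := eqVneq a b.
    by rewrite mdistxx mulr0; exact: reach_refl.
  have ab0 : 0 < mdist a b by rewrite mdist_gt0.
  have [|m am mb] := @geodesic_point a b (1/2); first lra.
  (* t' is the time at distance M * mdist a b / 2 from t in the direction of s. *)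
  pose th := M * mdist a b / 2 / `|s - t|.
  have th0 : 0 < th by rewrite !divr_gt0// mulr_gt0.
  have th1 : th <= 1 by rewrite ler_pdivrMr// mul1r; lra.
  pose t' := t + th * (s - t).
  have tt' : `|t - t'| = M * mdist a b / 2.
    by rewrite /t' opprD addNKr normrN normrM gtr0_norm// /th divfK// gt_eqF.
  have t'btw : between s t t'.
    by rewrite /t'; case: (leP s t) => h; [left|right]; nra.
  have It' := between_interval Is It t'btw.
  have step (w : X) (c : X) : mdist c w = mdist a b / 2 -> causal_step I f (t, c) (t', w).
    move=> cw; split => //=.
      by rewrite -subr_eq0 -normr_gt0 tt' divr_gt0// mulr_gt0.
    move=> u utt'; rewrite cw tt' -mulrA ler_wpM2r//; first lra.
    by apply: fM; case: utt' t'btw => ? [] ?; [left|right|left|right]; lra.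
  have := reach_trans (reach_step (step m a _)) (reach_sym (reach_step (step m b _))).
  rewrite /= tt' am => /(_ _ _)/reach_le; apply; [lra| |lra].
  by rewrite metric_sym mb; lra.
have [n] : exists n, M * mdist x y <= 2 ^+ n * `|s - t|.
  have h0 : 0 <= M * mdist x y / `|s - t| by rewrite divr_ge0 ?mulr_ge0 ?mdist_ge0// ltW.
  exists (Num.bound (M * mdist x y / `|s - t|)).
  rewrite -ler_pdivrMr//; apply: le_trans (ltW (archi_boundP h0)) _.
  by rewrite -natrX ler_nat ltnW// ltn_expl.
elim: n x y => [|n IH] x y h; first by apply: base; rewrite expr0 mul1r in h.
have [|m xm my] := @geodesic_point x y (1/2); first lra.
rewrite exprS in h.
apply: reach_le (reach_trans (IH x m _) (IH m y _)) _.
- by rewrite xm; lra.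
- by rewrite my; lra.
- by rewrite xm my; lra.
Qed.

(** If the step is not causal, run from s to t along the initial part of the
geodesic as far as causality permits, and cover the rest at the time t. *)
Lemma reach_max f (s t M : R) (x y : X) : I s -> I t -> s != t -> 0 < M ->
  (forall u, between s t u -> f u <= M) ->
  reach I f (s, x) (t, y) (Num.max `|s - t| (M * mdist x y)).
Proof.
move=> Is It st M0 fM.
have st0 : 0 < `|s - t| by rewrite normr_gt0 subr_eq0.
have [Mle|Mgt] := leP (M * mdist x y) `|s - t|.
  apply: reach_step; split => //= u /fM fuM; apply: le_trans Mle.
  by rewrite ler_wpM2r// mdist_ge0.
pose th := `|s - t| / (M * mdist x y).
have D0 : 0 < M * mdist x y by exact: lt_trans Mgt.
have thE : th * (M * mdist x y) = `|s - t| by rewrite /th divfK// gt_eqF.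
have [|m xm my] := @geodesic_point x y th.
  by rewrite divr_ge0 ?ler_pdivrMr ?mul1r//; exact: ltW.
have s1 : causal_step I f (s, x) (t, m).
  split => //= u /fM fuM; rewrite -thE xm mulrCA.
  have th0 : 0 < th by rewrite divr_gt0.
  by rewrite ler_pM2l// ler_wpM2r// mdist_ge0.
apply: reach_le (reach_trans (reach_step s1) (reach_same_time m y Is It st M0 fM)) _.
by rewrite /= my -thE; lra.
Qed.

(** A step that is causal for f and has time length h covers a distance d with
g d <= lam h, so reach_max applies with M = lam h / d. *)
Lemma reach_scale f g (lam : R) p q L : 1 <= lam ->
  (forall u, I u -> g u <= lam * f u) ->
  zigzag I f p q L -> reach I g p q (lam * L).
Proof.
move=> lam1 gf; elim=> [Ip|z {}q {}L _ IH [Iz Iq zq fzq]].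
  by rewrite mulr0; exact: reach_refl.
rewrite mulrDr; apply: reach_trans IH _.
have zq0 : 0 < `|z.1 - q.1| by rewrite normr_gt0 subr_eq0.
have [z2q2|z2q2] := eqVneq (mdist z.2 q.2) 0.
  apply: reach_le (reach_step (_ : causal_step I g z q)) _.
    by split => // u _; rewrite z2q2 mulr0 normr_ge0.
  by rewrite ler_peMl.
have d0 : 0 < mdist z.2 q.2 by rewrite lt_neqAle eq_sym z2q2 mdist_ge0.
pose M := lam * `|z.1 - q.1| / mdist z.2 q.2.
have M0 : 0 < M by rewrite divr_gt0// mulr_gt0//; lra.
have gM u : between z.1 q.1 u -> g u <= M.
  move=> btw; apply: le_trans (gf _ (between_interval Iz Iq btw)) _.
  by rewrite ler_pdivlMr// -mulrA ler_pM2l ?fzq//; lra.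
case: z q {fzq z2q2} Iz Iq zq zq0 d0 @M M0 gM => [s x] [t y] /=.
move=> Iz Iq zq zq0 d0 M0 gM.
apply: reach_le (reach_max x y Iz Iq zq M0 gM) _.
by rewrite divfK ?gt_eqF// ge_max lexx andbT ler_peMl.
Qed.

(** Stop inside the step during which the accumulated time variation reaches r; the
two parts into which a causal step is cut are causal steps. *)
Lemma zigzag_intermediate f p q L r : zigzag I f p q L -> 0 <= r <= L ->
  exists z, [/\ cone X I z, reach I f p z r & reach I f z q (L - r)].
Proof.
move=> pq; elim: pq r => [Ip|z {}q {}L pz IH zq] r /andP[r0 rL].
  exists p; have -> : r = 0 by lra.
  by rewrite subr0; split => //; exact: reach_refl.
have [rL'|Lr] := leP r L.
  have [|w [Iw pw wz]] := IH r; first by rewrite r0.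
  exists w; split => //.
  apply: reach_le (reach_trans wz (reach_step zq)) _; lra.
have [Iz Iq zq1 fzq] := zq.
have zq0 : 0 < `|z.1 - q.1| by rewrite normr_gt0 subr_eq0.
pose th := (r - L) / `|z.1 - q.1|.
have th0 : 0 < th by rewrite divr_gt0// subr_gt0.
have th1 : th <= 1 by rewrite ler_pdivrMr// mul1r; lra.
have thE : th * `|z.1 - q.1| = r - L by rewrite divfK// gt_eqF.
have reach_pz : reach I f p z L by exists L.
have [|m zm mq] := @geodesic_point z.2 q.2 th; first by rewrite (ltW th0).
pose w := (z.1 + th * (q.1 - z.1), m).
have zw : causal_step I f z w by apply: causal_step_partial; rewrite ?th0.
have [_ Iw _ _] := zw.
exists w; split => //.
  apply: reach_le (reach_trans reach_pz (reach_step zw)) _.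
  rewrite /= opprD addNKr normrN normrM gtr0_norm// distrC thE; lra.
move: th1; rewrite le_eqVlt => /predU1P[th1|th1].
  have -> : w = q.
    rewrite /w th1 mul1r addrC subrK; case: (q) mq => t y /= mq; congr pair.
    by apply: mdist_positivity; rewrite mq th1 subrr mul0r.
  by apply: reach_le (reach_refl _ _) _ => //; lra.
have qw : causal_step I f q w.
  have := causal_step_partial (causal_step_sym zq) (_ : 0 < 1 - th <= 1) (_ : mdist q.2 m = _).
  have -> : q.1 + (1 - th) * (z.1 - q.1) = w.1 by rewrite /w /=; lra.
  apply; first by apply/andP; split; lra.
  by rewrite metric_sym mq (metric_sym q.2).
apply: reach_le (reach_sym (reach_step qw)) _.
have -> : q.1 - w.1 = (1 - th) * (q.1 - z.1) by rewrite /w /=; lra.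
by rewrite normrM gtr0_norm ?subr_gt0// mulrBl mul1r distrC thE; lra.
Qed.

Context (I_nondeg : exists a b : R, [/\ I a, I b & a < b]).
Context (f : R -> R) (f_cont : {within I, continuous f})
  (f_pos : forall t, I t -> 0 < f t).

Lemma between_bounded (s t : R) : I s -> I t ->
  exists2 M, 0 < M & forall u, between s t u -> f u <= M.
Proof.
wlog st : s t / s <= t => [hw Is It|Is It].
  have [st|/ltW ts] := leP s t; first exact: hw.
  by have [M M0 MP] := hw _ _ ts It Is; exists M => // u /betweenC; exact: MP.
have sub : `[s, t]%classic `<=` I by move=> u /=; rewrite in_itv /=; exact: I_itv.
have [c cst cP] := EVT_max st (continuous_subspaceW sub f_cont).
exists (f c); first by apply: f_pos; apply: sub.
move=> u [ust|/andP[tu us]]; first by apply: cP; rewrite in_itv.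
by apply: cP; rewrite in_itv /=; lra.
Qed.

(** Go to a time b next to which f is bounded, change the spatial point there, and
go on to the time of q. *)
Lemma reach_bound : exists2 M : R * R, 0 < M.2 & forall p q, cone X I p -> cone X I q ->
  reach I f p q (`|p.1 - M.1| + M.2 * mdist p.2 q.2 + `|M.1 - q.1|).
Proof.
have [a [b [Ia Ib ab]]] := I_nondeg.
have [M M0 fM] := between_bounded Ia Ib.
have in_time s t (x : X) : I s -> I t -> reach I f (s, x) (t, x) `|s - t|.
  move=> Is It; have [->|st] := eqVneq s t.
    by rewrite subrr normr0; exact: reach_refl.
  by apply: (@reach_step _ _ I f (s, x) (t, x)); split => //= u _;
    rewrite mdistxx mulr0.
exists (b, M) => // -[s x] [t y] Is It /=.
have ab1 : a != b by rewrite lt_eqF.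
have in_space := reach_same_time x y Ia Ib ab1 M0 fM.
exact: reach_trans (reach_trans (in_time s b x Is Ib) in_space) (in_time b t y Ib It).
Qed.

Lemma reach_lt p q L : cone X I p -> cone X I q ->
  zigzag_dist I f p q < L -> exists2 L', zigzag I f p q L' & L' < L.
Proof.
move=> Ip Iq; rewrite -subr_gt0 => L0.
have [|L' pqL' L'lt] := @inf_adherent R [set L | zigzag I f p q L] _ L0.
  split; last by exists 0 => M; exact: zigzag_ge0.
  by have [M _ /(_ _ _ Ip Iq)[L' h _]] := reach_bound; exists L'.
by exists L' => //; move: L'lt; rewrite /zigzag_dist; lra.
Qed.

Lemma zigzag_dist_pseudometric : pseudometric_on (cone X I) (zigzag_dist I f).
Proof.
split=> [x Ix|x y Ix Iy|x y z Ix Iy Iz].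
- by apply/eqP; rewrite eq_le zigzag_dist_ge0 zigzag_dist_le//; exact: reach_refl.
- congr inf; apply/seteqP; split=> L /=; exact: zigzag_sym.
- apply/ler_addgt0Pr => e e0.
  have [|L xyL Le] := @reach_lt x y (zigzag_dist I f x y + e / 2) Ix Iy; first lra.
  have [|M yzM Me] := @reach_lt y z (zigzag_dist I f y z + e / 2) Iy Iz; first lra.
  apply: le_trans (zigzag_dist_le (_ : reach _ _ _ _ (L + M))) _; last lra.
  by exists (L + M) => //; exact: zigzag_trans yzM.
Qed.

Lemma zigzag_dist_intermediate :
  has_intermediate_points (cone X I) (zigzag_dist I f).
Proof.
move=> p q L r Ip Iq pqL /andP[r0 rL].
have [L' pqL' L'L] := reach_lt Ip Iq pqL.
have [rL'|L'r] := leP r L'.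
  have [|z [Iz pz zq]] := zigzag_intermediate pqL' (_ : 0 <= r <= L').
    by rewrite r0.
  exists z; split => //; first exact: zigzag_dist_le.
  by apply: le_trans (zigzag_dist_le zq) _; lra.
exists q; split => //.
  by apply: zigzag_dist_le; exists L' => //; exact: ltW.
apply: le_trans (zigzag_dist_le (reach_refl f Iq)) _; lra.
Qed.

Lemma zigzag_dist_bounded : compact I -> compact [set: X] ->
  exists2 C, 0 < C & forall p q, cone X I p -> cone X I q -> zigzag_dist I f p q <= C.
Proof.
move=> /compact_real_bounded[A AP] cX.
have [B BP] : exists B, forall x y : X, mdist x y <= B.
  have [[x0]|nX] := pselect (inhabited X); last first.
    by exists 0 => x; case: nX; exists.
  have cd : continuous (fun x : X => mdist x0 x).
    move=> x; apply/cvgrPdist_le => e e0; near=> y.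
    have xy : mdist x y < e.
      by near: y; apply: filterS (nbhsx_ballx x e e0) => z; rewrite ballEmdist.
    rewrite ler_norml; have := metric_triangle x0 x y.
    by have := metric_triangle x0 y x; rewrite (metric_sym y x); lra.
  have [B BP] := compact_real_bounded (continuous_compact (continuous_subspaceT cd) cX).
  exists (B + B) => x y; apply: le_trans (metric_triangle x x0 y) _.
  rewrite (metric_sym x); apply: lerD; (apply: le_trans (ler_norm _) _; apply: BP).
    by exists x.
  by exists y.
have [M M0 MP] := reach_bound.
pose C := `|A + `|M.1| + M.2 * B + `|M.1| + A|.
have C0 : 0 <= C by exact: normr_ge0.
exists (C + 1) => [|p q Ip Iq]; first lra.
apply: le_trans (zigzag_dist_le (MP _ _ Ip Iq)) _.
apply: (@le_trans _ _ C); last by rewrite lerDl.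
apply: le_trans (ler_norm _).
have := ler_wpM2l (ltW M0) (BP p.2 q.2).
have := AP _ Ip; have := AP _ Iq.
have := ler_normB p.1 M.1; have := ler_normB M.1 q.1; lra.
Unshelve. all: by end_near. Qed.

Lemma zigzag_dist_scale g (lam : R) p q : 1 <= lam ->
  (forall u, I u -> g u <= lam * f u) -> cone X I p -> cone X I q ->
  zigzag_dist I g p q <= lam * zigzag_dist I f p q.
Proof.
move=> lam1 gf Ip Iq; apply/ler_addgt0Pr => e e0.
have lam0 : 0 < lam by lra.
have [|L pqL Le] := @reach_lt p q (zigzag_dist I f p q + e / lam) Ip Iq.
  by rewrite ltrDl divr_gt0.
apply: le_trans (zigzag_dist_le (reach_scale lam1 gf pqL)) _.
have -> : e = lam * (e / lam) by rewrite mulrC divfK// gt_eqF.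
by rewrite -mulrDr ler_pM2l// ltW.
Qed.

End zigzag_estimates.

(** * From almost everywhere local bounds to global ones *)

Section ae_control.
Context {R : realType}.
Local Notation mu := (@lebesgue_measure R).

Lemma sum_length_le_measure (U : set R) n (u v : 'I_n -> R) : open U ->
  (forall i, u i <= v i) -> (forall i, `]u i, v i[%classic `<=` U) ->
  trivIset [set: 'I_n] (fun i => `]u i, v i[%classic) ->
  ((\sum_i (v i - u i))%:E <= mu U)%E.
Proof.
move=> oU uv UU tri; rewrite -sumEFin.
have muE i : (v i - u i)%:E = mu (`]u i, v i[%classic).
  rewrite lebesgue_measure_itv/= lte_fin; case: ltP => // vu.
  by have := uv i; move=> uvi; congr EFin; lra.
rewrite (eq_bigr _ (fun i _ => muE i)) -measure_semi_additive_ord//; last first.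
  by apply: bigsetU_measurable => i _; exact: measurable_itv.
apply: le_measure; rewrite ?inE.
- by apply: bigsetU_measurable => i _; exact: measurable_itv.
- exact: measurable_realfun.open_measurable.
- apply: (big_ind (fun A => A `<=` U)) => // A B AU BU.
  by rewrite subUset; split.
Qed.

(** Let S be the set of s such that rho a s is at most e (s - a) plus a sum of
rho over disjoint intervals contained in an open neighbourhood U, of small
measure, of the exceptional null set. Then S contains sup S, and can be continued beyond it:
by the local bound if sup S is not in U, and by adding one more interval if it
is. So b belongs to S, and the extra sum is small by the absolute continuity of
rho. *)
Lemma ae_local_control (a b : R) (rho : R -> R -> R) : a <= b ->
  rho a a <= 0 ->
  (forall s t u, a <= s -> s <= t -> t <= u -> u <= b ->
     rho s u <= rho s t + rho t u) ->
  (forall e : R, 0 < e -> exists2 r : R, 0 < r &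
    forall (n : nat) (u v : 'I_n -> R),
      (forall i, a <= u i /\ u i <= v i /\ v i <= b) ->
      trivIset [set: 'I_n] (fun i => `]u i, v i[%classic) ->
      \sum_i (v i - u i) < r -> \sum_i rho (u i) (v i) < e) ->
  {ae mu, forall s, s \in `]a, b[ -> forall e : R, 0 < e ->
     exists2 r : R, 0 < r & forall s1 s2, a <= s1 -> s1 <= s -> s <= s2 ->
       s2 <= b -> s2 - s1 < r -> rho s1 s2 <= e * (s2 - s1)} ->
  rho a b <= 0.
Proof.
move=> ab rho_aa rho_tri rho_ac rho_ae; apply/ler_addgt0Pr => e0 e00; rewrite add0r.
pose e := e0 / (b - a + 1).
have ba1 : 0 < b - a + 1 by lra.
have e_gt0 : 0 < e by rewrite divr_gt0.
have eE : e * (b - a) + e = e0 by rewrite -[X in _ + X]mulr1 -mulrDr divfK// gt_eqF.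
have [r r0 rP] := rho_ac _ e_gt0.
have [N [mN muN badN]] : mu.-negligible (~` [set s | s \in `]a, b[ ->
    forall e : R, 0 < e -> exists2 r : R, 0 < r & forall s1 s2, a <= s1 ->
      s1 <= s -> s <= s2 -> s2 <= b -> s2 - s1 < r ->
      rho s1 s2 <= e * (s2 - s1)] `|` ([set a] `|` [set b])).
  have neg1 x : mu.-negligible [set x].
    by apply/negligibleP; [exact: measurable_set1|exact: lebesgue_measure_set1].
  by apply: (negligibleU rho_ae); exact: negligibleU.
have [|U [oU NU muUN]] := lebesgue_regularity_outer mN _ r0.
  by move: muN => /= ->; rewrite ltry.
have muU : (mu U < r%:E)%E.
  have mU := measurable_realfun.open_measurable oU.
  apply: le_lt_trans muUN; rewrite -[leRHS]adde0 -muN.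
  rewrite -[in leLHS](setDUK NU) setUC.
  apply: (@le_trans _ _ (mu (U `\` N) + mu N)%E) => //.
  by apply: measureU2 => //; exact: measurableD.
have good c : c \in `[a, b] -> ~ U c -> (c \in `]a, b[) /\
    exists2 r : R, 0 < r & forall s1 s2, a <= s1 ->
      s1 <= c -> c <= s2 -> s2 <= b -> s2 - s1 < r -> rho s1 s2 <= e * (s2 - s1).
  move=> cab Uc.
  have cI : c \in `]a, b[.
    have ca : c != a by apply/eqP => ca; apply/Uc/NU/badN; right; left.
    have cb : c != b by apply/eqP => cb; apply/Uc/NU/badN; right; right.
    by move: cab; rewrite !in_itv/= !le_eqVlt (eq_sym a) (negbTE ca) (negbTE cb).
  split => //; apply: contrapT => h; apply/Uc/NU/badN; left => /(_ cI _ e_gt0).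
  exact: h.
(* Q s: rho a s is controlled up to a finite family of intervals inside U. *)
pose Q s := exists n (u v : 'I_n -> R),
  [/\ forall i, a <= u i /\ u i <= v i /\ v i <= s,
      trivIset [set: 'I_n] (fun i => `]u i, v i[%classic),
      forall i, `]u i, v i[%classic `<=` U &
      rho a s <= e * (s - a) + \sum_i rho (u i) (v i)].
have Qgood s1 s2 : a <= s1 -> s1 <= s2 -> s2 <= b -> Q s1 ->
    rho s1 s2 <= e * (s2 - s1) -> Q s2.
  move=> as1 s12 s2b [n [u [v [uv tri UU le1]]]] le2; exists n, u, v; split => //.
    by move=> i; have [? [? ?]] := uv i; do 2 split => //; exact: le_trans s12.
  by have := rho_tri _ _ _ (lexx a) as1 s12 s2b; lra.
have QU s1 s2 : a <= s1 -> s1 <= s2 -> s2 <= b -> Q s1 ->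
    `]s1, s2[%classic `<=` U -> Q s2.
  move=> as1 s12 s2b [n [u [v [uv tri UU le1]]]] sU.
  pose ext (w : 'I_n -> R) x (i : 'I_n.+1) := if unlift ord_max i is Some j then w j else x.
  have extE w x (i : 'I_n) : ext w x (widen_ord (leqnSn n) i) = w i.
    rewrite /ext (_ : widen_ord _ i = lift ord_max i) ?liftK//.
    by apply/val_inj; rewrite /= /bump leqNgt ltn_ord.
  exists n.+1, (ext u s1), (ext v s2); split.
  - move=> i; rewrite /ext; case: unliftP => [j _|_]; last by do 2 split => //.
    by have [? [? ?]] := uv j; do 2 split => //; exact: le_trans s12.
  - move=> i j _ _ [x []]; rewrite /ext /=.
    case: unliftP => [i' ->|->]; case: unliftP => [j' ->|->] => //.
    + by move=> xi xj; congr lift; apply: tri => //; exists x.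
    + rewrite !in_itv/= => /andP[_ xv] /andP[sx _].
      by have [_ [_ vs]] := uv i'; have := lt_le_trans xv vs; rewrite ltNge (ltW sx).
    + rewrite !in_itv/= => /andP[sx _] /andP[_ xv].
      by have [_ [_ vs]] := uv j'; have := lt_le_trans xv vs; rewrite ltNge (ltW sx).
  - by move=> i; rewrite /ext; case: unliftP => [j _|_].
  - rewrite big_ord_recr/= (eq_bigr (fun i => rho (u i) (v i))); last first.
      by move=> i _; rewrite !extE.
    rewrite /ext unlift_none; have := rho_tri _ _ _ (lexx a) as1 s12 s2b.
    have : 0 <= e * (s2 - s1) by rewrite mulr_ge0 ?subr_ge0// ltW.
    lra.
pose S := [set s | a <= s /\ s <= b /\ Q s].
have Sa : S a.
  do 2 split => //; exists 0, (fun=> 0), (fun=> 0); split => [[]//|[]//|[]//|].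
  by rewrite big_ord0 subrr mulr0 addr0.
have supS : has_sup S by split; [exists a|exists b => s [_ []]].
pose c := sup S.
have ac : a <= c by apply: ub_le_sup => //; case: supS.
have cb : c <= b by apply: ge_sup; [exists a|move=> s [_ []]].
have [d d0 dP] : exists2 d, 0 < d & forall s1 s2, a <= s1 -> s1 <= c ->
    c <= s2 -> s2 <= b -> s2 - s1 < d -> Q s1 -> Q s2.
  have [Uc|Uc] := pselect (U c).
    have /nbhs_ballP[d /= d0 dU] : nbhs c U by exact: open_nbhs_nbhs.
    exists d => // s1 s2 as1 s1c cs2 s2b s12 Q1; apply: QU Q1 _ => //.
      exact: le_trans cs2.
    move=> x /=; rewrite in_itv/= => /andP[s1x xs2]; apply: dU.
    by rewrite /ball/= ltr_norml; lra.
  have [|cI [d d0 dP]] := good c _ Uc; first by rewrite in_itv/= ac.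
  exists d => // s1 s2 as1 s1c cs2 s2b s12 Q1; apply: Qgood Q1 _ => //.
    exact: le_trans cs2.
  exact: dP.
have d2 : 0 < d / 2 by lra.
have [s1 [as1 [s1b Q1]] cs1] := sup_adherent d2 supS.
have s1c : s1 <= c by apply: ub_le_sup => //; case: supS.
pose s2 := Num.min b (c + d / 4).
have cs2 : c <= s2 by rewrite le_min cb /=; lra.
have s2b : s2 <= b by rewrite ge_min lexx.
have s2c : s2 <= c + d / 4 by rewrite ge_min lexx orbT.
have Q2 : Q s2 by apply: dP Q1 => //; rewrite -/c in cs1; lra.
have s2c' : s2 <= c.
  apply: ub_le_sup; first by case: supS.
  by split; [exact: le_trans ac cs2|split].
have s2E : s2 = b.
  by move: s2c'; rewrite /s2 ge_min => /orP[bc|]; [rewrite minElt; case: ifP; lra|lra].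
rewrite s2E in Q2; have [n [u [v [uv tri UU le1]]]] := Q2.
apply: le_trans le1 _; rewrite -eE lerD2l; apply/ltW/rP => //.
rewrite -lte_fin; apply: le_lt_trans muU; apply: sum_length_le_measure => //.
by move=> i; have [_ []] := uv i.
Qed.

End ae_control.

(** * Causal curves are not shorter than zigzags *)

Section first_order_expansions.
Context {R : realType} {X : metricType R}.

Lemma near0_dnbhs_ball (P : R -> Prop) : P 0 -> (\forall h \near 0^', P h) ->
  exists2 d : R, 0 < d & forall h, `|h| < d -> P h.
Proof.
move=> P0 [d /= d0 dP]; exists d => // h hd; have [->//|h0] := eqVneq h 0.
by apply: dP => //=; rewrite sub0r normrN.
Qed.

Lemma derivable_expansion (h : R -> R) s (e : R) : derivable h s 1 -> 0 < e ->
  exists2 d : R, 0 < d & forall k, `|k| < d ->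
    `|h (s + k) - h s - derive1 h s * k| <= e * `|k|.
Proof.
move=> dh e0; apply: near0_dnbhs_ball.
  by rewrite addr0 subrr mulr0 subr0 normr0 mulr0.
have /cvgrPdist_le/(_ _ e0) := dh.
rewrite -[lim _]/('D_1 h s) -derive1E; apply: filterS2 (nbhs_dnbhs_neq (0 : R)) => k k0 /=.
rewrite [k *: _]mulr1 [k^-1 *: _]/(_ * _) => hk.
have -> : h (s + k) - h s - derive1 h s * k =
    - ((derive1 h s - k^-1 * (h (k + s) - h s)) * k).
  by rewrite mulrBl -mulrA mulrCA mulVf// mulr1 (addrC k); ring.
by rewrite normrN normrM ler_wpM2r.
Qed.

Lemma metric_derivative_expansion (g : R -> X) s v (e : R) :
  has_metric_derivative g s v -> 0 < e ->
  exists2 d : R, 0 < d & forall k, `|k| < d ->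
    mdist (g s) (g (s + k)) <= (v + e) * `|k|.
Proof.
move=> dg e0; apply: near0_dnbhs_ball.
  by rewrite addr0 mdistxx normr0 mulr0.
have /cvgrPdist_le/(_ _ e0) := dg.
apply: filterS2 (nbhs_dnbhs_neq (0 : R)) => k k0 /=.
have k_gt0 : 0 < `|k| by rewrite normr_gt0.
by rewrite distrC ler_distl => /andP[_]; rewrite ler_pdivrMr.
Qed.

Lemma within_continuous_le (I : set R) (f : R -> R) s (e : R) :
  {within I, continuous f} -> I s -> 0 < e ->
  exists2 d : R, 0 < d & forall t, I t -> `|t - s| < d -> f t <= f s + e.
Proof.
move=> /subspace_continuousP/(_ s) fc Is e0.
have /cvgrPdist_le/(_ _ e0)[d /= d0 dP] := fc Is.
exists d => // t It ts; have := dP t; rewrite /= distrC => /(_ ts It).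
by rewrite /from_subspace /= distrC ler_distl => /andP[].
Qed.

End first_order_expansions.

Section causal_lower_bound.
Context {R : realType} {X : metricType R} (geoX : geodesic_space X).
Context (I : set R) (I_itv : is_interval I)
  (I_nondeg : exists a b : R, [/\ I a, I b & a < b]).
Context (f : R -> R) (f_cont : {within I, continuous f})
  (f_pos : forall t, I t -> 0 < f t).

(** A sign makes time differences along a strictly monotone function additive, so
that increasing and decreasing ones are treated alike. *)
Lemma strictly_monotone_sign (a b : R) (h : R -> R) : strictly_monotone a b h ->
  exists sg : R, forall s t, a <= s -> s < t -> t <= b ->
    `|h t - h s| = sg * (h t - h s) /\ 0 < `|h t - h s|.
Proof.
case=> mon; [exists 1|exists (-1)] => s t as_ st tb;
    have := mon s t; rewrite !in_itv/= as_ tb (le_trans as_ (ltW st))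
      (le_trans (ltW st) tb) => /(_ isT isT st) hst.
  by rewrite gtr0_norm ?subr_gt0// mul1r.
by rewrite ltr0_norm ?subr_lt0// mulN1r oppr_gt0 subr_lt0.
Qed.

Lemma strictly_monotone_between (a b s t : R) (h : R -> R) :
  strictly_monotone a b h -> a <= s -> s <= t -> t <= b ->
  forall w, between (h s) (h t) w -> between (h a) (h b) w.
Proof.
move=> mon as_ st tb w.
have sb := le_trans st tb; have at_ := le_trans as_ st; have ab := le_trans at_ tb.
have lew (c : R -> R) : {in `[a, b] &, forall x y, x < y -> c x < c y} ->
    c a <= c s /\ c s <= c t /\ c t <= c b.
  move=> cmon; have cle x y : a <= x -> x <= y -> y <= b -> c x <= c y.
    move=> ax; rewrite le_eqVlt => /predU1P[->//|xy] yb; apply/ltW/cmon => //.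
      by rewrite in_itv/= ax (le_trans (ltW xy)).
    by rewrite in_itv/= yb (le_trans ax (ltW xy)).
  by split; [|split]; apply: cle.
case: mon => [/lew[h1 [h2 h3]]|mon].
  case=> /andP[h4 h5]; left; lra.
have [|h1 [h2 h3]] := lew (fun x => - h x).
  by move=> x y xab yab xy; rewrite ltrN2; exact: mon.
case=> /andP[h4 h5]; right; lra.
Qed.

(** Apply ae_local_control to the excess rho s t of the zigzag distance of g s and
g t over the time elapsed. By reach_max this excess is at most
M d - |time elapsed| or 0, where d is the distance of the spatial parts and M
bounds f on the times between.
With a global M this yields absolute continuity of rho; near a parameter where
the derivatives exist, M is close to f and the causality inequality f v <= |A|,
A being the derivative of the time, leaves an error of first
order as small as one wishes. *)
Lemma zigzag_dist_causal_le (a b : R) (g : R -> R * X) : causal_curve I f a b g ->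
  zigzag_dist I f (g a) (g b) <= `|(g a).1 - (g b).1|.
Proof.
move=> [ab gI [_ bac] mon gae].
have [sg sgP] := strictly_monotone_sign mon.
have Ig s : a <= s -> s <= b -> I (g s).1.
  by move=> as_ sb; apply: gI; rewrite in_itv/= as_.
have [D0 _ Dtri] := zigzag_dist_pseudometric geoX I_itv I_nondeg f_cont f_pos.
pose rho s t := zigzag_dist I f (g s) (g t) - sg * ((g t).1 - (g s).1).
suff : rho a b <= 0.
  by rewrite /rho subr_le0 distrC; have [-> _] := sgP _ _ (lexx a) ab (lexx b).
have rho_ss s : a <= s -> s <= b -> rho s s <= 0.
  by move=> as_ sb; rewrite /rho D0 ?subrr ?mulr0//; exact: Ig.
have rho_le s t M : a <= s -> s < t -> t <= b -> 0 < M ->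
    (forall u, between (g s).1 (g t).1 u -> f u <= M) ->
    rho s t <= Num.max 0 (M * mdist (g s).2 (g t).2 - `|(g t).1 - (g s).1|).
  move=> as_ st tb M0 fM; have [E E0] := sgP _ _ as_ st tb.
  have Is := Ig _ as_ (le_trans (ltW st) tb); have It := Ig _ (le_trans as_ (ltW st)) tb.
  have gst : (g s).1 != (g t).1.
    by rewrite eq_sym -subr_eq0 -normr_gt0.
  have := zigzag_dist_le (reach_max geoX I_itv (g s).2 (g t).2 Is It gst M0 fM).
  rewrite -!surjective_pairing /rho -[sg * _]E distrC.
  by rewrite !maxEle; do 2 case: ifP; lra.
apply: ae_local_control (ltW ab) _ _ _ _.
- exact: rho_ss (ltW ab).
- move=> s t u as_ st tu ub; rewrite /rho.
  have := Dtri (g s) (g t) (g u) (Ig _ _ _) (Ig _ _ _) (Ig _ _ _).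
  by move=> /(_ _ _ _ _ _ _) h; have := h as_ (le_trans st (le_trans tu ub))
    (le_trans as_ st) (le_trans tu ub) (le_trans as_ (le_trans st tu)) ub; lra.
- have [M M0 fM] := between_bounded I_itv f_cont f_pos (Ig _ (lexx a) (ltW ab))
    (Ig _ (ltW ab) (lexx b)).
  move=> e e0; have [r r0 rP] := bac _ (divr_gt0 e0 M0).
  exists r => // n u v uv tri uvr; have := rP n u v uv tri uvr.
  rewrite ltr_pdivlMr// mulrC mulr_sumr; apply: le_lt_trans.
  apply: ler_sum => i _; have [au [uvi vb]] := uv i.
  have Md0 : 0 <= M * mdist (g (u i)).2 (g (v i)).2.
    by rewrite mulr_ge0 ?mdist_ge0// ltW.
  move: uvi; rewrite le_eqVlt => /predU1P[E|uvi].
    by rewrite -E in Md0 vb *; exact: le_trans (rho_ss _ au vb) Md0.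
  apply: le_trans (rho_le _ _ M au uvi vb M0 _) _.
    move=> w btw; apply: fM.
    exact: (strictly_monotone_between mon au (ltW uvi) vb).
  by rewrite ge_max Md0/= lerBlDr lerDl.
- have FF := ae_filter_ringOfSetsType (@lebesgue_measure R).
  apply: (@filterS _ _ FF) gae => s sP sab e e0.
  have [dalpha [v dbeta caus]] := sP sab.
  move: sab; rewrite in_itv/= => /andP[as_ sb].
  set al := fst \o g in dalpha caus; set A := derive1 al s in caus.
  set F := f (al s) in caus.
  have Is : I (al s) by apply: Ig; exact: ltW.
  have F0 : 0 < F by exact: f_pos.
  have FvA : F * `|v| <= `|A|.
    rewrite -[F]gtr0_norm// -normrM -ler_sqr ?nnegrE// !real_normK ?num_real//.
    by rewrite exprMn; lra.
  have v0 := normr_ge0 v.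
  (* eta is the error in the three first order expansions; eta * K bounds the
     total error of rho relative to s2 - s1. *)
  pose K := F + `|v| + 2.
  have K0 : 0 < K by rewrite /K; lra.
  pose eta := Num.min 1 (e / K).
  have eta0 : 0 < eta by rewrite lt_min ltr01 divr_gt0.
  have eta1 : eta <= 1 by rewrite ge_min lexx.
  have etaK : eta * K <= e by rewrite -ler_pdivlMr// ge_min lexx orbT.
  have [d1 d10 d1P] := derivable_expansion dalpha eta0.
  have [d2 d20 d2P] := metric_derivative_expansion dbeta eta0.
  have [d3 d30 d3P] := within_continuous_le f_cont Is eta0.
  pose c := `|A| + 1.
  have c0 : 0 < c by rewrite ltr_wpDl.
  exists (Num.min (Num.min d1 d2) (d3 / c)).
    by rewrite !lt_min d10 d20 divr_gt0.
  move=> s1 s2 as1 s1s ss2 s2b; rewrite !lt_min => /andP[/andP[sd1 sd2]].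
  rewrite ltr_pdivlMr// => sd3.
  have := le_trans s1s ss2; rewrite le_eqVlt => /predU1P[<-|s12].
    by rewrite subrr mulr0; apply: rho_ss => //; exact: le_trans (ltW sb).
  have close k : s1 <= k <= s2 -> [/\ `|al k - al s - A * (k - s)| <= eta * `|k - s|,
      mdist (g s).2 (g k).2 <= (`|v| + eta) * `|k - s| & `|al k - al s| < d3].
    move=> /andP[s1k ks2].
    have ks : `|k - s| <= s2 - s1 by rewrite ler_norml; lra.
    have kE : s + (k - s) = k by rewrite addrC subrK.
    have := d1P (k - s) (le_lt_trans ks sd1); rewrite kE -/A => h1.
    have := d2P (k - s) (le_lt_trans ks sd2); rewrite kE => h2.
    split => //.
      apply: le_trans h2 _; rewrite ler_wpM2r// lerD2r; exact: ler_norm.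
    apply: le_lt_trans sd3.
    have -> : al k - al s = (al k - al s - A * (k - s)) + A * (k - s) by ring.
    apply: le_trans (ler_normD _ _) _; rewrite normrM.
    have := normr_ge0 A; have := normr_ge0 (k - s); rewrite /c; nra.
  have [|a1 b1 c1] := close s1 _; first by rewrite lexx ltW.
  have [|a2 b2 c2] := close s2 _; first by rewrite lexx ltW.
  have M0 : 0 < F + eta by rewrite addr_gt0.
  apply: le_trans (rho_le s1 s2 (F + eta) as1 s12 s2b M0 _) _.
    move=> u btw; apply: d3P.
      exact: between_interval I_itv _ _ _ (Ig _ as1 (le_trans (ltW s12) s2b))
        (Ig _ (le_trans as1 (ltW s12)) s2b) btw.
    move: c1 c2; rewrite /al /= !ltr_norml; case: btw; lra.
  have n1 : `|s1 - s| = s - s1 by rewrite ler0_norm ?subr_le0// opprB.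
  have n2 : `|s2 - s| = s2 - s by rewrite ger0_norm ?subr_ge0.
  rewrite n1 in a1 b1; rewrite n2 in a2 b2.
  have ds : mdist (g s1).2 (g s2).2 <= (`|v| + eta) * (s2 - s1).
    apply: le_trans (metric_triangle _ (g s).2 _) _.
    rewrite metric_sym; apply: le_trans (lerD b1 b2) _.
    by rewrite -mulrDr; lra.
  have da : (`|A| - eta) * (s2 - s1) <= `|al s2 - al s1|.
    have : `|A * (s2 - s1)| <= `|al s2 - al s1| + eta * (s2 - s1).
      have -> : A * (s2 - s1) = (al s2 - al s1) + ((al s1 - al s - A * (s1 - s)) -
        (al s2 - al s - A * (s2 - s))) by ring.
      apply: le_trans (ler_normD _ _) _; rewrite lerD2l.
      apply: le_trans (ler_normB _ _) _; apply: le_trans (lerD a1 a2) _.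
      by rewrite -mulrDr; lra.
    by rewrite normrM (gtr0_norm (_ : 0 < s2 - s1)) ?subr_gt0//; lra.
  have s21 : 0 < s2 - s1 by rewrite subr_gt0.
  rewrite ge_max mulr_ge0 ?(ltW e0) ?(ltW s21)//=.
  rewrite -/(al s2) -/(al s1).
  have := ler_wpM2l (ltW M0) ds.
  have : (F + eta) * (`|v| + eta) <= `|A| + eta * (K - 1).
    rewrite /K; have := ler_wpM2l (ltW eta0) eta1; nra.
  move=> h1 h2.
  have := ler_wpM2r (ltW s21) h1; have := ler_wpM2r (ltW s21) etaK; lra.
Qed.

End causal_lower_bound.

(** * Zigzags are causal curves, and the null distance *)

Section causal_curves.
Context {R : realType} {X : metricType R}.
Implicit Types (I : set R) (f : R -> R) (p q : R * X) (g h : R -> R * X).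

Lemma lipschitz_abs_cont (Y : metricType R) (a b K : R) (g : R -> Y) :
  (forall u v, a <= u -> u <= v -> v <= b -> mdist (g u) (g v) <= K * (v - u)) ->
  abs_cont a b g.
Proof.
move=> gK e e0; pose K' := `|K| + 1.
have K'0 : 0 < K' by rewrite ltr_wpDl.
exists (e / K') => [|n u v uv _]; first exact: divr_gt0.
rewrite ltr_pdivlMr// mulrC mulr_sumr; apply: le_lt_trans; apply: ler_sum => i _.
have [au [uvi vb]] := uv i; apply: le_trans (gK _ _ au uvi vb) _.
rewrite ler_wpM2r ?subr_ge0//; apply: le_trans (ler_norm _) _.
by rewrite /K' lerDl.
Qed.

Lemma near_itvoo (a b s : R) : s \in `]a, b[ -> \forall t \near s, t \in `[a, b].
Proof.
move=> sab; near=> t; apply: subset_itv_oo_cc; near: t.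
exact: near_in_itvoo.
Unshelve. all: by end_near. Qed.

Lemma near_shift_itv (a b s : R) : s \in `]a, b[ ->
  \forall k \near 0^', s + k \in `[a, b].
Proof.
move=> /near_itvoo/nbhs_ballP[d /= d0 dP]; exists d => // k /=.
rewrite sub0r normrN => kd _; apply: dP.
by rewrite /ball /= opprD addNKr normrN.
Qed.

Lemma near_eq_derive1 (h k : R -> R) (s : R) : {near s, h =1 k} ->
  derive1 h s = derive1 k s.
Proof. by move=> hk; rewrite !derive1E; exact: near_eq_derive. Qed.

(** Only the values on [a, b] matter; this allows one to glue curves. *)
Lemma causal_curve_congr I f (a b : R) g h : {in `[a, b], g =1 h} ->
  causal_curve I f a b g -> causal_curve I f a b h.
Proof.
move=> gh [ab gI [ca cb] mon gae].
have ac (Y : metricType R) (c : R * X -> Y) :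
    abs_cont a b (c \o g) -> abs_cont a b (c \o h).
  move=> acg e e0; have [r r0 rP] := acg e e0; exists r => // n u v uv tri uvr.
  rewrite (eq_bigr (fun i => mdist ((c \o g) (u i)) ((c \o g) (v i)))); first exact: rP.
  move=> i _; have [au [uvi vb]] := uv i.
  by rewrite /= !gh// in_itv/= ?au ?vb ?(le_trans uvi)// (le_trans au).
split => //.
- by move=> s sab; rewrite -gh//; exact: gI.
- by split; [exact: (ac R^o fst)|exact: ac].
- by case: mon => mon; [left|right] => s t sab tab st; rewrite /= -!gh//; exact: mon.
- have FF := ae_filter_ringOfSetsType (@lebesgue_measure R).
  apply: (@filterS _ _ FF) gae => s sP sab; have [dal [v dbe le]] := sP sab.
  have sab' : s \in `[a, b] by exact: subset_itv_oo_cc.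
  have nearh : {near s, (fst \o g) =1 (fst \o h)}.
    by apply: filterS (near_itvoo sab) => t tab; rewrite /= gh.
  split; first exact: near_eq_derivable nearh dal.
  exists v; last by rewrite -(near_eq_derive1 nearh) /= -gh.
  rewrite /has_metric_derivative /=.
  apply: cvg_trans dbe; apply: near_eq_cvg.
  by apply: filterS (near_shift_itv sab) => k kab; rewrite /= !gh.
Qed.

Lemma causal_curve_future I f (a b : R) g h : {in `[a, b], g =1 h} ->
  future_causal I f a b g -> future_causal I f a b h.
Proof.
move=> gh [cg gae]; split; first exact: causal_curve_congr cg.
have FF := ae_filter_ringOfSetsType (@lebesgue_measure R).
apply: (@filterS _ _ FF) gae => s sP sab.
rewrite -(@near_eq_derive1 (fst \o g)); first exact: sP.
by apply: filterS (near_itvoo sab) => t tab; rewrite /= gh.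
Qed.

Lemma causal_curve_past I f (a b : R) g h : {in `[a, b], g =1 h} ->
  past_causal I f a b g -> past_causal I f a b h.
Proof.
move=> gh [cg gae]; split; first exact: causal_curve_congr cg.
have FF := ae_filter_ringOfSetsType (@lebesgue_measure R).
apply: (@filterS _ _ FF) gae => s sP sab.
rewrite -(@near_eq_derive1 (fst \o g)); first exact: sP.
by apply: filterS (near_itvoo sab) => t tab; rewrite /= gh.
Qed.

Context (geoX : geodesic_space X) (I : set R) (I_itv : is_interval I)
  (f : R -> R) (f_pos : forall t, I t -> 0 < f t).

(** Linear in time and geodesic in space. The geodesic has constant metric
derivative, so the causality inequality is the defining inequality of a causal step. *)
Lemma causal_step_curve p q (b : R) : causal_step I f p q ->
  exists g : R -> R * X, [/\ g b = p, g (b + 1) = q,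
    {in `[b, b + 1], forall s, cone X I (g s)} &
    future_causal I f b (b + 1) g \/ past_causal I f b (b + 1) g].
Proof.
case: p q => [t x] [t' y] [/= It It' tt' ftt'].
have [c [c0 c1 cE]] := geoX x y.
pose al (s : R) := t + (s - b) * (t' - t).
pose g (s : R) := (al s, c (s - b)).
have inI s : b <= s -> s <= b + 1 -> between t t' (al s).
  by move=> bs sb; rewrite /al; have [h|h] := leP t t'; [left|right]; nra.
have bet s : s \in `[b, b + 1] -> between t t' (al s).
  by rewrite in_itv/= => /andP[]; exact: inI.
have dal (s : R) : is_derive s (1 : R) al (t' - t).
  rewrite /al; apply: is_derive_eq.
  by rewrite scaler0 !add0r subr0 mul1r [_%:A]mulr1.
have dalE s : derive1 (fst \o g) s = t' - t.
  by rewrite derive1E; exact: (@derive_val _ _ _ _ _ _ _ (dal s)).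
have cdist u v : b <= u -> u <= v -> v <= b + 1 ->
    mdist (c (u - b)) (c (v - b)) = mdist x y * (v - u).
  move=> bu uv vb; rewrite cE; [|lra|lra].
  by rewrite mulrC distrC ger0_norm; [congr *%R; lra|lra].
have cg : causal_curve I f b (b + 1) g.
  split.
  - by rewrite ltrDl.
  - by move=> s /bet; exact: between_interval.
  - split.
      apply: (@lipschitz_abs_cont _ _ _ `|t' - t|) => u v bu uv vb.
      rewrite /mdist /= /al (_ : _ - _ = (v - u) * (t' - t)); last by ring.
      by rewrite normrM mulrC (@ger0_norm _ (v - u)) ?subr_ge0.
    apply: (@lipschitz_abs_cont _ _ _ (mdist x y)) => u v bu uv vb.
    by rewrite /= cdist.
  - move: tt'; rewrite neq_lt => /orP[tt'|tt']; [left|right] => u v _ _ uv /=;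
      by rewrite /al ltrD2l; nra.
  - apply: aeW => s sb; split; first by have [] := dal s.
    exists (mdist x y); last first.
      have bs := bet s (subset_itv_oo_cc sb).
      rewrite dalE /= addrC subr_le0 -exprMn -[leRHS]real_normK ?num_real//.
      rewrite ler_sqr ?nnegrE//; first by rewrite distrC; exact: ftt'.
      rewrite mulr_ge0 ?mdist_ge0// ltW// f_pos//.
      exact: between_interval It It' bs.
    rewrite /has_metric_derivative /=.
    apply: (@cvg_trans _ ((fun=> mdist x y) @ 0^')); last exact: cvg_cst.
    apply: near_eq_cvg.
    have sb' := subset_itv_oo_cc sb; move: sb'; rewrite in_itv/= => /andP[bs sb'].
    apply: filterS2 (nbhs_dnbhs_neq (0 : R)) (near_shift_itv sb) => k k0.
    rewrite in_itv/= => /andP[bk kb].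
    have k_gt0 : 0 < `|k| by rewrite normr_gt0.
    rewrite cE; [|lra|lra]; rewrite (_ : s - b - (s + k - b) = - k); last by ring.
    by rewrite normrN mulrAC mulfV ?mul1r// gt_eqF.
exists g; split.
- by rewrite /g /al subrr mul0r addr0 c0.
- by rewrite /g /al (_ : b + 1 - b = 1) ?mul1r ?(addrC t) ?subrK ?c1//; ring.
- by move=> s /bet; exact: between_interval.
- move: tt'; rewrite neq_lt => /orP[tt'|tt']; [left|right]; split => //.
    by apply: aeW => s _; rewrite dalE subr_gt0.
  by apply: aeW => s _; rewrite dalE subr_lt0.
Qed.

Lemma piecewise_causal_nth_itv (a b : R) s g i : piecewise_causal I f a b s g ->
  (i <= size s)%N -> nth b (a :: s) i \in `[a, b].
Proof.
move=> [part _ _] si; rewrite in_itv/=.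
by rewrite (itv_partition_nth_ge _ part) ?(itv_partition_nth_le _ part).
Qed.

(** Each causal step is appended on a new parameter interval [b, b + 1]. *)
Lemma zigzag_curve p q L : zigzag I f p q L ->
  exists (a b : R) (s : seq R) (g : R -> R * X),
    [/\ a <= b, piecewise_causal I f a b s g, g a = p, g b = q &
        variation a b (fst \o g) s = L].
Proof.
elim=> [Ip|z {}q {}L _ [a [b [s [g [ab pc ga gb var]]]]] zq].
  exists 0, 0, [::], (fun=> p); split => //; last exact: variation_nil.
  by split => //; split => //=; rewrite eqxx.
have [h [hb hb1 hI hc]] := causal_step_curve b zq.
pose g' t := if t <= b then g t else h t.
have g'g : {in `[a, b], g =1 g'}.
  by move=> t; rewrite in_itv/= /g' => /andP[_ ->].
have g'h : {in `[b, b + 1], h =1 g'}.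
  move=> t; rewrite in_itv/= /g' => /andP[bt _]; case: leP => // tb.
  have -> : t = b by lra.
  by rewrite hb gb.
have bb1 : b < b + 1 by rewrite ltrDl.
have part1 := itv_partition1 bb1.
have [part gI pieces] := pc.
have pieceE i : (i <= size s)%N ->
    nth (b + 1) (a :: (s ++ [:: b + 1])) i = nth b (a :: s) i.
  move=> si; rewrite -cat_cons nth_cat /= ltnS si.
  by apply: set_nth_default; rewrite /= ltnS.
exists a, (b + 1), (s ++ [:: b + 1]), g'; split.
- by rewrite (le_trans ab)// ltW.
- split; first exact: itv_partition_cat part part1.
    move=> t; rewrite in_itv/= => /andP[at_ tb1]; have [tb|/ltW bt] := leP t b.
      have tab : t \in `[a, b] by rewrite in_itv/= at_.
      by rewrite -g'g//; exact: gI.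
    have tab : t \in `[b, b + 1] by rewrite in_itv/= bt.
    by rewrite -g'h//; exact: hI.
  move=> i; rewrite size_cat addn1 ltnS leq_eqVlt => /predU1P[->|si].
    rewrite pieceE// (itv_partition_nth_size _ part).
    rewrite -cat_cons nth_cat /= ltnn subnn /=.
    by case: hc => hc; [apply: Or32; exact: causal_curve_future hc
                       |apply: Or33; exact: causal_curve_past hc].
  rewrite !pieceE// ?(ltnW si)//; have := pieces i si => /=.
  have ui := piecewise_causal_nth_itv pc (ltnW si).
  have /= vi := piecewise_causal_nth_itv pc si.
  move: (nth b (a :: s) i) (nth b s i) ui vi => u v; rewrite !in_itv/=.
  move=> /andP[au ub] /andP[av vb].
  have gg' : {in `[u, v], g =1 g'}.
    move=> t; rewrite in_itv/= => /andP[ut tv]; apply: g'g.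
    by rewrite in_itv/= (le_trans au ut) (le_trans tv vb).
  case=> hg.
  + apply: Or31 => t tuv; have := tuv; rewrite in_itv/= => /andP[ut tv].
    by rewrite -!gg' ?hg// in_itv/= lexx (le_trans ut tv).
  + by apply: Or32; exact: causal_curve_future hg.
  + by apply: Or33; exact: causal_curve_past hg.
- by rewrite -g'g// in_itv/= lexx.
- by rewrite -g'h ?hb1// in_itv/= lexx ltW.
- rewrite (variation_cat _ ab (ltW bb1) part part1); congr +%R.
    rewrite -var; apply: eq_big_nat => i /andP[_ si] /=.
    rewrite -(g'g _ (piecewise_causal_nth_itv pc (ltnW si))).
    by rewrite -(g'g (nth b s i))//; exact: (piecewise_causal_nth_itv pc si).
  rewrite /variation big_nat1 /= -(g'g b) ?in_itv/= ?ab ?lexx//.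
  rewrite -(g'h (b + 1)) ?in_itv/= ?lexx ?ltW//.
  by rewrite hb1 gb distrC.
Qed.

Context (I_nondeg : exists a b : R, [/\ I a, I b & a < b])
  (f_cont : {within I, continuous f}).

Lemma zigzag_dist_le_variation (a b : R) (s : seq R) g :
  piecewise_causal I f a b s g ->
  zigzag_dist I f (g a) (g b) <= variation a b (fst \o g) s.
Proof.
move=> pc; have [part gI pieces] := pc.
have [D0 _ Dtri] := zigzag_dist_pseudometric geoX I_itv I_nondeg f_cont f_pos.
have Inth i : (i <= size s)%N -> cone X I (g (nth b (a :: s) i)).
  by move=> si; apply: gI; exact: (piecewise_causal_nth_itv pc si).
suff : forall k, (k <= size s)%N -> zigzag_dist I f (g a) (g (nth b (a :: s) k)) <=
    \sum_(0 <= i < k) `|(g (nth b (a :: s) i.+1)).1 - (g (nth b (a :: s) i)).1|.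
  by move=> /(_ _ (leqnn _)); rewrite (itv_partition_nth_size _ part); exact: id.
elim=> [|k IH] ks; first by rewrite big_geq// D0//; exact: (Inth 0%N).
rewrite big_nat_recr//=.
apply: le_trans (Dtri _ _ _ (Inth 0%N isT) (Inth _ (ltnW ks)) (Inth _ ks)) _.
apply: lerD; first exact: IH (ltnW ks).
rewrite distrC; have := pieces k ks => /=; case=> [cst|[cc _]|[cc _]].
- rewrite cst ?D0 ?normr_ge0//; first exact: (Inth k (ltnW ks)).
  rewrite in_itv/= lexx andbT.
  move: part => [/(pathP b)/(_ k ks)/ltW]; exact.
- exact: zigzag_dist_causal_le cc.
- exact: zigzag_dist_causal_le cc.
Qed.

Lemma null_distE p q : cone X I p -> cone X I q ->
  null_dist I f p q = (zigzag_dist I f p q)%:E.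
Proof.
move=> Ip Iq; apply/eqP; rewrite eq_le; apply/andP; split; last first.
  apply: le_ereal_inf_tmp => _ [a [b [s [g [_ pc <- <- ->]]]]].
  by rewrite lee_fin; exact: zigzag_dist_le_variation.
apply/lee_addgt0Pr => e e0; rewrite -EFinD.
have [|L pqL Le] := @reach_lt _ _ geoX _ I_itv I_nondeg _ f_cont f_pos p q
  (zigzag_dist I f p q + e) Ip Iq; first by rewrite ltrDl.
have [a [b [s [g [ab pc ga gb var]]]]] := zigzag_curve pqL.
apply: (@le_trans _ _ L%:E); last by rewrite lee_fin ltW.
by apply: ereal_inf_lbound; exists a, b, s, g; split; rewrite ?var.
Qed.

End causal_curves.

(** * Convergence *)

Lemma compact_proper (R : realType) (X : metricType R) :
  compact [set: X] -> proper_space X.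
Proof. by move=> cX A cA _; exact: subclosed_compact cA cX _. Qed.

Lemma uniform_cvg_le (R : realType) (I : set R) (f_ : nat -> R -> R) (f : R -> R) :
  {uniform I, f_ @ \oo --> f} -> forall e : R, 0 < e ->
  \forall n \near \oo, forall t, I t -> `|f t - f_ n t| <= e.
Proof.
move=> fu e e0.
have /fu : nbhs (f : {uniform` I -> R}) [set h | forall t, I t -> `|f t - h t| <= e].
  apply/uniform_nbhs; exists [set xy : R * R | ball xy.1 e xy.2]; split.
    exact: (entourage_ball _ (PosNum e0)).
  by move=> h hP t It; apply/ltW/hP.
by [].
Qed.

(** The lower bound c turns the additive error (lam - 1) c into a factor lam. *)
Lemma uniform_limit_ratio (R : realType) (I : set R) (f_ : nat -> R -> R)
    (f : R -> R) (c : R) : 0 < c -> (forall n t, I t -> c <= f_ n t) ->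
  {uniform I, f_ @ \oo --> f} -> forall lam : R, 1 < lam ->
  \forall n \near \oo, (forall t, I t -> f_ n t <= lam * f t) /\
                       (forall t, I t -> f t <= lam * f_ n t).
Proof.
move=> c0 cf fu lam lam1.
have cf' t : I t -> c <= f t.
  move=> It; apply/ler_addgt0Pr => e e0.
  have [n /(_ t It)] := filter_ex (uniform_cvg_le fu e0).
  by rewrite ler_norml => /andP[]; have := cf n t It; lra.
have e0 : 0 < (lam - 1) * c by rewrite mulr_gt0// subr_gt0.
apply: filterS (uniform_cvg_le fu e0) => n close; split=> t It;
  have := close t It; rewrite ler_norml => /andP[h1 h2].
  by have := ler_wpM2l (ltW (_ : 0 < lam - 1)) (cf' t It); rewrite subr_gt0 => /(_ lam1); lra.
by have := ler_wpM2l (ltW (_ : 0 < lam - 1)) (cf n t It); rewrite subr_gt0 => /(_ lam1); lra.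
Qed.

(** The factor lam = 1 + min 1 (e / K) keeps the error (lam - 1) K of the
Gromov-Hausdorff estimates below e, as well as lam <= 2. *)
Lemma eventually_for_factor_near1 (R : realType) (P : R -> nat -> Prop) (K e : R) :
  0 < K -> 0 < e ->
  (forall lam, 1 < lam -> \forall n \near \oo, P lam n) ->
  exists lam, [/\ 1 < lam, lam <= 2, (lam - 1) * K <= e &
     \forall n \near \oo, P lam n].
Proof.
move=> K0 e0 evP; pose lam := 1 + Num.min 1 (e / K).
have eK : 0 < e / K by rewrite divr_gt0.
have lam1 : 1 < lam by rewrite ltrDl lt_min ltr01.
exists lam; split => //; last exact: evP.
  have min1 : Num.min 1 (e / K) <= 1 by rewrite ge_min lexx.
  by rewrite /lam; lra.
by rewrite /lam addrAC subrr add0r -ler_pdivlMr// ge_min lexx orbT.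
Qed.

Theorem corollary4p15 (R : realType) (I : set R) (X : metricType R)
    (f_ : nat -> R -> R) (f : R -> R)
    (I_itv : is_interval I)
    (I_nondeg : exists a b : R, [/\ I a, I b & a < b])
    (X_length : length_space X)
    (f_cont : forall n, {within I, continuous (f_ n)})
    (f_pos : forall n t, I t -> 0 < f_ n t)
    (f_lb : exists2 c : R, 0 < c & forall n t, I t -> c <= f_ n t)
    (flim_pos : forall t, I t -> 0 < f t)
    (f_unif : {uniform I, f_ @ \oo --> f}) :
  (proper_space X -> forall p0 : R * X, cone X I p0 ->
     pointed_gh_cvg (fun _ => cone X I) (fun n => null_dist I (f_ n)) (fun _ => p0)
                    (cone X I) (null_dist I f) p0) /\
  (compact I -> compact [set: X] ->
     gh_cvg (fun _ => cone X I) (fun n => null_dist I (f_ n))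
            (cone X I) (null_dist I f)).
Proof.
have flim_cont : {within I, continuous f}.
  apply: uniform_limit_continuous_subspace f_unif.
  exact: (@filterE _ \oo _ _ f_cont).
have [c c0 cf] := f_lb.
have ratio := uniform_limit_ratio c0 cf f_unif.
have scale (geoX : geodesic_space X) lam n : 1 < lam ->
    (forall t, I t -> f_ n t <= lam * f t) /\ (forall t, I t -> f t <= lam * f_ n t) ->
    (forall x y, cone X I x -> cone X I y ->
       zigzag_dist I (f_ n) x y <= lam * zigzag_dist I f x y) /\
    (forall x y, cone X I x -> cone X I y ->
       zigzag_dist I f x y <= lam * zigzag_dist I (f_ n) x y).
  move=> /ltW lam1 [le1 le2]; split => x y Ix Iy.
    exact: zigzag_dist_scale Ix Iy.
  exact: (zigzag_dist_scale geoX I_itv I_nondeg (f_cont n) (f_pos n)) Ix Iy.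
split=> [pX p0 Ip0 r r0|cI cX].
  have geoX : geodesic_space X.
    by move=> x y; exact: proper_length_space_geodesic.
  apply: cvge0_eventually_le => [n|e e0]; first exact: pointed_gh_dist_ge0.
  have K0 : 0 < 20 * r by rewrite mulr_gt0.
  have [lam [lam1 lam2 lamK]] := eventually_for_factor_near1 K0 e0 ratio.
  apply: filterS => n /(scale geoX _ _ lam1)[le1 le2].
  apply: (@le_trans _ _ ((lam - 1) * (20 * r))%:E); last by rewrite lee_fin.
  apply: pointed_gh_dist_le lam1 lam2 le1 le2 => //.
  - exact: (zigzag_dist_pseudometric geoX I_itv I_nondeg (f_cont n) (f_pos n)).
  - exact: (zigzag_dist_pseudometric geoX I_itv I_nondeg flim_cont flim_pos).
  - exact: (zigzag_dist_intermediate geoX I_itv I_nondeg (f_cont n) (f_pos n)).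
  - exact: (zigzag_dist_intermediate geoX I_itv I_nondeg flim_cont flim_pos).
  - exact: (null_distE geoX I_itv (f_pos n) I_nondeg (f_cont n)).
  - exact: (null_distE geoX I_itv flim_pos I_nondeg flim_cont).
have geoX : geodesic_space X.
  by move=> x y; apply: proper_length_space_geodesic => //; exact: compact_proper.
have [C C0 CP] := zigzag_dist_bounded geoX I_itv I_nondeg flim_cont flim_pos cI cX.
apply: cvge0_eventually_le => [n|e e0]; first exact: gh_dist_ge0.
have K0 : 0 < 4 * C by rewrite mulr_gt0.
have [lam [lam1 lam2 lamK]] := eventually_for_factor_near1 K0 e0 ratio.
apply: filterS => n /(scale geoX _ _ lam1)[le1 le2].
apply: (@le_trans _ _ ((lam - 1) * (4 * C))%:E); last by rewrite lee_fin.
apply: gh_dist_le C0 CP lam1 lam2 le1 le2.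
- exact: (zigzag_dist_pseudometric geoX I_itv I_nondeg (f_cont n) (f_pos n)).
- exact: (zigzag_dist_pseudometric geoX I_itv I_nondeg flim_cont flim_pos).
- exact: (null_distE geoX I_itv (f_pos n) I_nondeg (f_cont n)).
- exact: (null_distE geoX I_itv flim_pos I_nondeg flim_cont).
Qed.
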